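(* Let $q$ be a prime with $2 \leq q < 10^5$. Every integer $n > 4$ can be written as $n = p_1 + p_2 + \eta$, where $p_1, p_2$ are primes (not necessarily distinct) and $\eta$ is a square-free number co-prime to $q$.
   Context: A square-free number is a positive integer not divisible by the square of any prime; in particular $1$ is square-free. *)

(* Defs.v *)
From mathcomp Require Import all_boot.

Set Implicit Arguments.
Unset Strict Implicit.
Unset Printing Implicit Defensive.

Definition square_free (m : nat) : Prop :=
  0 < m /\ forall p : nat, prime p -> ~~ (p ^ 2 %| m).

(* Main.v *)
Require Import Defs.
From HB Require Import structures.
From Stdlib Require Import Reals Lra.
From mathcomp Require Import all_boot zify.

(** Only an even number [m = n - 2] or [n - 3] has to be written as an odd prime
    plus a square-free number prime to an odd prime [q] (for [q = 2] any odd [q]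
    will do, the square-free part being odd).  A prime [p] fails when [q] or some
    [r ^ 2], [r] an odd prime, divides [m - p], i.e. when [p] lies in one residue
    class modulo [2 * q] or [2 * r ^ 2].  For a class [a] modulo [k] and [N] terms,
    [N!] divides [prod_(j < N) (a + j * k)] up to the primes of [k], and the
    primes [p > N] of the class divide the quotient; so the primes up to [x] in
    the class contribute at most about [x * c / k] to Chebyshev's theta function,
    where [c = ln k + sum_(p | k) ln p / (p - 1)].  Summed over all bad classes
    this is below [0.88 * x], while Chebyshev's quotient
    [(30n)! n! / ((15n)! (10n)! (6n)!)] gives [theta x >= 0.92 * x].  The
    comparison is effective for [m >= 2 ^ 24].  Below, the same union bound is
    applied to the odd primes up to some [y <= m] of size a few times [sqrt m]:
    each [r ^ 2 > y] rules out at most one of them, so finitely many class counts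
    settle whole ranges of [m] at once. *)

Set Implicit Arguments.
Unset Strict Implicit.
Unset Printing Implicit Defensive.

(** * Primes in one residue class *)

Lemma fact_dvd_ffact n m : n`! %| m ^_ n.
Proof. by rewrite -bin_ffact dvdn_mull. Qed.

Lemma fact_dvd_rising c n : n`! %| \prod_(j < n) (c + j).
Proof.
case: n => [|n]; first by rewrite big_ord0.
case: c => [|c]; first by rewrite big_ord_recl add0n mul0n dvdn0.
suff -> : \prod_(j < n.+1) (c.+1 + j) = (c + n.+1) ^_ n.+1 by apply: fact_dvd_ffact.
rewrite ffact_prod (reindex_inj rev_ord_inj) /=.
by apply: eq_bigr => i _; have := ltn_ord i; lia.
Qed.

(* Multiplying each factor by an inverse of [k] modulo [M] turns the progression
   into consecutive integers. *)
Lemma fact_coprime_part_dvd_AP a k n M :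
  coprime k M -> M %| n`! -> M %| \prod_(j < n) (a + j * k).
Proof.
move=> ckM Mdvd; have [M0|M_gt0] := posnP M.
  by move: Mdvd; rewrite M0 dvd0n -leqn0 leqNgt fact_gt0.
have [k0|k_gt0] := posnP k.
  by move: ckM; rewrite k0 /coprime gcd0n => /eqP ->; rewrite dvd1n.
case: (egcdnP M k_gt0) => u v euv _; move: euv; rewrite (eqP ckM) => euv.
have cuM : coprime u M.
  rewrite /coprime -dvdn1 -(@dvdn_addr (v * M)) ?dvdn_mull ?dvdn_gcdr //.
  by rewrite -euv dvdn_mulr ?dvdn_gcdl.
rewrite -(@Gauss_dvdr _ (u ^ n)); last by rewrite coprime_sym coprimeXl.
have -> : u ^ n * \prod_(j < n) (a + j * k) = \prod_(j < n) (u * (a + j * k)).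
  by rewrite big_split /= prod_nat_const card_ord.
suff e : \prod_(j < n) (u * (a + j * k)) = \prod_(j < n) (u * a + j) %[mod M].
  by rewrite /dvdn e; apply: (dvdn_trans Mdvd (fact_dvd_rising (u * a) n)).
apply: (big_ind2 (fun x y => x = y %[mod M])) => [//|x1 x2 y1 y2 e1 e2|j _].
  by rewrite -modnMm e1 e2 modnMm.
rewrite mulnDr [u * (j * k)]mulnCA euv.
have -> : u * a + j * (v * M + 1) = j * v * M + (u * a + j) by nia.
by rewrite modnMDl.
Qed.

Lemma prod_primes_dvd (s : seq nat) Q :
  uniq s -> {in s, forall p, prime p && (p %| Q)} -> \prod_(p <- s) p %| Q.
Proof.
elim: s => [|p s IHs] /=; first by rewrite big_nil dvd1n.
case/andP=> ps us h; rewrite big_cons Gauss_dvd.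
  have /andP[_ ->] := h p (mem_head _ _).
  by apply: IHs => // r rs; apply: h; rewrite inE rs orbT.
rewrite big_seq; elim/big_ind: _ => [|x y|r rs]; first exact: coprimen1.
  by rewrite coprimeMr => -> ->.
have /andP[pp _] := h p (mem_head _ _).
have /andP[pr _] : prime r && (r %| Q) by apply: h; rewrite inE rs orbT.
rewrite prime_coprime // dvdn_prime2 //; apply: contraNneq ps => ->.
by [].
Qed.

Lemma logn_fact_le p n : prime p -> logn p n`! * p.-1 <= n.
Proof.
move=> pp; rewrite logn_fact // .
have p_gt0 := prime_gt0 pp.
(* Keeping the remainder [n %/ p ^ k] on the left makes Legendre's sum telescope like a geometric
   series. *)
suff h k : (\sum_(1 <= i < k.+1) n %/ p ^ i) * p.-1 + n %/ p ^ k <= n.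
  by apply: leq_trans (h n); apply: leq_addr.
elim: k => [|k IHk]; first by rewrite big_geq // expn0 divn1.
rewrite big_nat_recr //=; apply: leq_trans IHk.
rewrite mulnDl -addnA leq_add2l -[X in _ + X]muln1 -mulnDr addn1 prednK //.
by rewrite expnSr divnMA leq_trunc_div.
Qed.

(** Let [Q] be the quotient of [A * B] by the factorial of [N]. Each prime of [s] is one of the [N]
    terms multiplied in [A] and, being above [N], is prime to that factorial; hence their product
    divides [Q]. The size of [Q] follows from [a + j * k <= (j + 1) * k]. *)
Lemma prime_class_prod_le (s : seq nat) a k N :
  0 < a <= k -> coprime a k -> uniq s ->
  {in s, forall p, [/\ prime p, N < p, p <= N * k & p = a %[mod k]]} ->
  \prod_(p <- s) p <= k ^ N * (N`!)`_(\pi(k)).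
Proof.
case/andP=> a_gt0 a_le ca us hs.
have k_gt0 : 0 < k by apply: leq_trans a_le.
set B := (N`!)`_(\pi(k)); set A := \prod_(j < N) (a + j * k).
have A_gt0 : 0 < A by apply: prodn_gt0 => j; rewrite addn_gt0 a_gt0.
have Ndvd : N`! %| A * B.
  rewrite -(@partnC \pi(k) N`!) ?fact_gt0 // mulnC dvdn_mul //.
  apply: fact_coprime_part_dvd_AP; last exact: dvdn_part.
  by apply: (@pnat_coprime \pi(k)); rewrite ?part_pnat // pnat_pi.
case/dvdnP: Ndvd => Q eQ.
have Q_gt0 : 0 < Q.
  have : 0 < A * B by rewrite muln_gt0 A_gt0 part_gt0.
  by rewrite eQ muln_gt0 => /andP[].
apply: (@leq_trans Q).
  apply: dvdn_leq => //; apply: prod_primes_dvd => // p ps.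
  have [pp Np pN ep] := hs p ps; rewrite pp /=.
  have pN' : coprime p N`!.
    rewrite prime_coprime // fact_prod Euclid_dvd_prod // big_has.
    apply/hasP => -[i]; rewrite mem_index_iota => /andP[i_gt0 iN] /dvdn_leq.
    by lia.
  rewrite -(Gauss_dvdl _ pN') -eQ dvdn_mulr //.
  have p_ge : a <= p.
    rewrite leqNgt; apply/negP => lt.
    have := modn_small (leq_trans lt a_le); rewrite ep.
    case/boolP: (a == k) => [/eqP ->|ak]; first by rewrite modnn => p0; move: pp; rewrite -p0.
    by rewrite modn_small; lia.
  have kd : k %| p - a by rewrite -eqn_mod_dvd // ep.
  case/dvdnP: kd => j ej; have jN : j < N by nia.
  rewrite /A (bigD1 (Ordinal jN)) //= dvdn_mulr //.
  by rewrite -ej subnKC.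
rewrite -(leq_pmul2r (fact_gt0 N)) -eQ mulnAC leq_mul2r; apply/orP; right.
rewrite /A fact_prod big_add1 /= big_mkord -[X in k ^ X](card_ord N) -prod_nat_const -big_split /=.
by apply: leq_prod => j _; nia.
Qed.

Delimit Scope R_scope with R.

(** * Finite sums of logarithms *)

Fact Rplus_0_l' : left_id R0 Rplus. Proof. exact: Rplus_0_l. Qed.
Fact Rplus_comm' : commutative Rplus. Proof. exact: Rplus_comm. Qed.
Fact Rplus_assoc' : associative Rplus.
Proof. by move=> x y z; rewrite Rplus_assoc. Qed.

HB.instance Definition _ :=
  Monoid.isComLaw.Build R R0 Rplus Rplus_assoc' Rplus_comm' Rplus_0_l'.

Notation "\rsum_ ( i <- r | P ) F" := (\big[Rplus/R0]_(i <- r | P%B) F%R)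
  (at level 41, F at level 41, i, r at level 50).
Notation "\rsum_ ( i <- r ) F" := (\big[Rplus/R0]_(i <- r) F%R)
  (at level 41, F at level 41, i, r at level 50).
Notation "\rsum_ ( m <= i < n | P ) F" := (\big[Rplus/R0]_(m <= i < n | P%B) F%R)
  (at level 41, F at level 41, i, m, n at level 50).
Notation "\rsum_ ( m <= i < n ) F" := (\big[Rplus/R0]_(m <= i < n) F%R)
  (at level 41, F at level 41, i, m, n at level 50).

Lemma rsum_ge0 (I : Type) (r : seq I) (P : pred I) (F : I -> R) :
  (forall i, P i -> (0 <= F i)%R) -> (0 <= \rsum_(i <- r | P i) F i)%R.
Proof.
by move=> h; elim/big_ind: _ => [|x y|i /h //]; [apply: Rle_refl | apply: Rplus_le_le_0_compat].
Qed.

Lemma rsum_le (I : eqType) (r : seq I) (P : pred I) (F G : I -> R) :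
  (forall i, i \in r -> P i -> (F i <= G i)%R) ->
  (\rsum_(i <- r | P i) F i <= \rsum_(i <- r | P i) G i)%R.
Proof.
move=> h; rewrite big_seq_cond [X in (_ <= X)%R]big_seq_cond.
apply: (big_ind2 (fun x y => (x <= y)%R)) => [|x1 x2 y1 y2|i /andP[]].
- exact: Rle_refl.
- exact: Rplus_le_compat.
exact: h.
Qed.

Lemma rsum_le_cond (I : eqType) (r : seq I) (P Q : pred I) (F : I -> R) :
  (forall i, i \in r -> P i -> Q i) -> (forall i, (0 <= F i)%R) ->
  (\rsum_(i <- r | P i) F i <= \rsum_(i <- r | Q i) F i)%R.
Proof.
move=> h F0; rewrite big_mkcond [X in (_ <= X)%R]big_mkcond /=.
apply: rsum_le => i ir _; case: ifP => [/(h i ir) -> | _]; first exact: Rle_refl.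
by case: ifP => // _; exact: Rle_refl.
Qed.

Lemma rsum_distrr (I : Type) (r : seq I) (P : pred I) (F : I -> R) c :
  (\rsum_(i <- r | P i) (c * F i) = c * \rsum_(i <- r | P i) F i)%R.
Proof.
elim: r => [|i r IHr]; first by rewrite !big_nil Rmult_0_r.
by rewrite !big_cons; case: (P i); rewrite IHr // Rmult_plus_distr_l.
Qed.

Definition lnn (n : nat) : R := ln (INR n).

Lemma INR_gt0 n : 0 < n -> (0 < INR n)%R.
Proof. by move=> ?; apply: lt_0_INR; lia. Qed.

Lemma leq_INR m n : m <= n -> (INR m <= INR n)%R.
Proof. by move=> ?; apply: le_INR; lia. Qed.

Lemma INR_addn m n : INR (m + n) = (INR m + INR n)%R.
Proof. exact: plus_INR. Qed.

Lemma INR_muln m n : INR (m * n) = (INR m * INR n)%R.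
Proof. exact: mult_INR. Qed.

Lemma lnn1 : lnn 1 = 0%R.
Proof. exact: ln_1. Qed.

Lemma lnnM m n : 0 < m -> 0 < n -> lnn (m * n) = (lnn m + lnn n)%R.
Proof. by move=> m0 n0; rewrite /lnn INR_muln ln_mult //; apply: INR_gt0. Qed.

Lemma lnnX m n : 0 < m -> lnn (m ^ n) = (INR n * lnn m)%R.
Proof.
move=> m0; elim: n => [|n IHn]; first by rewrite expn0 lnn1 Rmult_0_l.
by rewrite expnS lnnM ?expn_gt0 ?m0 // IHn S_INR; ring.
Qed.

Lemma lnn_le m n : 0 < m -> m <= n -> (lnn m <= lnn n)%R.
Proof.
move=> m0; rewrite leq_eqVlt => /orP[/eqP->|mn]; first exact: Rle_refl.
by apply/Rlt_le/ln_increasing; [apply: INR_gt0 | apply: lt_INR; lia].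
Qed.

Lemma lnn_ge0 n : (0 <= lnn n)%R.
Proof.
case: n => [|n]; last by rewrite -lnn1; apply: lnn_le.
(* At [n = 0] the logarithm takes its default value [0]. *)
by rewrite /lnn /= /ln; case: Rlt_dec => // h; [case: (Rlt_irrefl 0) | exact: Rle_refl].
Qed.

Lemma lnn_prod (I : Type) (r : seq I) (P : pred I) (F : I -> nat) :
  (forall i, P i -> 0 < F i) ->
  lnn (\prod_(i <- r | P i) F i) = \rsum_(i <- r | P i) lnn (F i).
Proof.
move=> h; elim: r => [|i r IHr]; first by rewrite !big_nil lnn1.
rewrite !big_cons; case: ifP => // Pi.
by rewrite lnnM ?IHr ?h // prodn_cond_gt0.
Qed.

(** Growth rate in [N] of the logarithm of the bound in [prime_class_prod_le]: [lnn k] comes from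
    [k ^ N], the sum from the part of the factorial built from the primes of [k]. *)
Definition class_const (k : nat) : R :=
  (lnn k + \rsum_(p <- primes k) (lnn p / INR p.-1))%R.

Lemma lnn_part_fact_le k N :
  (lnn (N`!)`_(\pi(k)) <= INR N * \rsum_(p <- primes k) (lnn p / INR p.-1))%R.
Proof.
(* The factorial may be smaller than [k]; the widened range contains every prime of [k]. *)
rewrite (widen_partn _ (leq_maxl N`! k)).
have -> : \prod_(0 <= p < (maxn N`! k).+1 | p \in \pi(k)) p ^ logn p N`!
          = \prod_(p <- primes k) p ^ logn p N`!.
  rewrite -big_filter; apply: perm_big; apply: uniq_perm.
  - by rewrite filter_uniq // iota_uniq.
  - exact: primes_uniq.
  move=> p; rewrite mem_filter /= mem_index_iota.
  apply: andb_idr => /= pk; rewrite ltnS leq_max orbC.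
  by move: pk; rewrite mem_primes => /and3P[_ k0 /(dvdn_leq k0) ->].
rewrite [X in lnn X]big_seq lnn_prod; last first.
  by move=> p; rewrite mem_primes => /andP[/prime_gt0 p0 _]; rewrite expn_gt0 p0.
rewrite -rsum_distrr [X in (_ <= X)%R]big_seq; apply: rsum_le => p _ pk.
have pp : prime p by move: pk; rewrite mem_primes => /andP[].
have p1 := prime_gt1 pp.
rewrite lnnX ?prime_gt0 //.
have q0 : (0 < INR p.-1)%R by apply: INR_gt0; lia.
have := leq_INR (logn_fact_le N pp); rewrite INR_muln => h.
have l0 := lnn_ge0 p.
have -> : (INR N * (lnn p / INR p.-1) = INR N / INR p.-1 * lnn p)%R by field; lra.
apply: Rmult_le_compat_r => //.
apply: (Rmult_le_reg_r (INR p.-1)) => //.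
by have -> : (INR N / INR p.-1 * INR p.-1 = INR N)%R by field; lra.
Qed.

(** Chebyshev's theta function with a lower cutoff: primes above [s] cannot divide moduli built from
    primes [r <= s], and the sum is empty once [x <= s]. *)
Definition theta (s x : nat) (P : pred nat) : R :=
  \rsum_(0 <= p < x.+1 | [&& (s < p)%N, prime p & P p]) lnn p.

Lemma class_const_ge0 k : (0 <= class_const k)%R.
Proof.
rewrite /class_const; have := lnn_ge0 k.
suff : (0 <= \rsum_(p <- primes k) (lnn p / INR p.-1))%R by lra.
rewrite big_seq; apply: rsum_ge0 => p; rewrite mem_primes => /andP[pp _].
apply: Rmult_le_pos; first exact: lnn_ge0.
by apply/Rlt_le/Rinv_0_lt_compat/INR_gt0; have := prime_gt1 pp; lia.
Qed.

Lemma theta_cat s x N P : N <= x ->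
  theta s x P = (theta s N P +
    \rsum_(N.+1 <= p < x.+1 | [&& (s < p)%N, prime p & P p]) lnn p)%R.
Proof. by move=> Nx; rewrite /theta (big_cat_nat _ (n := N.+1)). Qed.

(** * Theta restricted to one residue class *)

Section ThetaClass.
Variables (s k : nat) (P : pred nat).
Hypothesis k_gt1 : 1 < k.
Hypothesis P_coprime : forall p, s < p -> prime p -> P p -> coprime p k.
Hypothesis P_class : forall p p', s < p -> prime p -> P p ->
  s < p' -> prime p' -> P p' -> p = p' %[mod k].

(* The primes [p <= N], about which the quotient by [N!] says nothing, are left over;
   [theta_class_le] disposes of them by iterating this step. *)
Lemma theta_step x N : x <= N * k ->
  (theta s x P <= INR N * class_const k + theta s N P)%R.
Proof.
move=> xN.
have NC : (0 <= INR N * class_const k)%R.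
  by apply: Rmult_le_pos; [apply: pos_INR | apply: class_const_ge0].
have [xltN|Nx] := leqP x N.
  rewrite (theta_cat s P xltN).
  set t := \rsum_(_ <= _ < _ | _) _.
  have : (0 <= t)%R by apply: rsum_ge0 => *; apply: lnn_ge0.
  by lra.
rewrite (theta_cat s P (ltnW Nx)) Rplus_comm; apply: Rplus_le_compat_r.
rewrite -big_filter; set L := filter _ _.
have hL p : p \in L -> [/\ N < p, p <= x, s < p, prime p & P p].
  by rewrite mem_filter mem_index_iota => /andP[/and3P[? ? ?] /andP[? ?]].
case eL : L => [|p0 L']; first by rewrite big_nil.
have [_ _ sp0 pp0 Pp0] : [/\ N < p0, p0 <= x, s < p0, prime p0 & P p0].
  by apply: hL; rewrite eL mem_head.
rewrite -eL.
have L_le : \prod_(p <- L) p <= k ^ N * (N`!)`_(\pi(k)).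
  apply: (@prime_class_prod_le _ (p0 %% k)).
  (* The residue of [p0] is positive because [p0] is prime to [k > 1]. *)
  - have c := P_coprime sp0 pp0 Pp0.
    apply/andP; split; last by apply/ltnW/ltn_pmod/ltnW.
    rewrite lt0n; apply: contraTneq c => e; rewrite /coprime gcdnC -gcdn_modr e gcdn0.
    by rewrite neq_ltn k_gt1 orbT.
  - by rewrite coprime_modl; apply: P_coprime.
  - by rewrite filter_uniq // iota_uniq.
  move=> p /hL[Np px sp pp Pp]; split=> //; first exact: leq_trans xN.
  by rewrite modn_mod; apply: P_class.
have L0 : 0 < \prod_(p <- L) p.
  by rewrite big_seq; apply: prodn_cond_gt0 => p /hL[_ _ _ /prime_gt0].
have := lnn_le L0 L_le.
rewrite big_seq lnn_prod; last by move=> p /hL[_ _ _ /prime_gt0].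
rewrite -big_seq lnnM ?part_gt0 ?expn_gt0 ?(ltnW k_gt1) // lnnX ?(ltnW k_gt1) //.
move=> h; apply: Rle_trans h _; rewrite /class_const Rmult_plus_distr_l.
exact/Rplus_le_compat_l/lnn_part_fact_le.
Qed.

(** Each step replaces [x] by [x / k] rounded up. The geometric series adds up to [x / (k - 1)], and
    the rounding costs at most one extra unit per step. As [k >= 2], [j] steps bring [x] down to
    [s], where theta vanishes. *)
Lemma theta_class_le j x : x <= s * 2 ^ j ->
  (theta s x P <= class_const k * (INR x / INR k.-1 + INR j))%R.
Proof.
have C0 := class_const_ge0 k.
have k0 : (0 < INR k.-1)%R by apply: INR_gt0; lia.
elim: j x => [|j IHj] x xs.
  rewrite /theta big_nat_cond big_pred0; last first.
    by move=> p; move: xs; rewrite expn0 muln1; lia.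
  apply: Rmult_le_pos => //; rewrite Rplus_0_r.
  by apply: Rmult_le_pos; [apply: pos_INR | apply/Rlt_le/Rinv_0_lt_compat].
pose N := (x + k.-1) %/ k.
have xN : x <= N * k.
  by have := divn_eq (x + k.-1) k; have := ltn_pmod (x + k.-1) (ltnW k_gt1); rewrite -/N; lia.
have Nx : N * k <= x + k.-1 by apply: leq_trunc_div.
have Ns : N <= s * 2 ^ j.
  rewrite -ltnS ltn_divLR; last exact: ltnW.
  by move: xs; rewrite expnS; nia.
apply: Rle_trans (theta_step xN) _.
apply: Rle_trans (Rplus_le_compat_l _ _ _ (IHj _ Ns)) _.
have h : (INR N * INR k <= INR x + INR k.-1)%R.
  by rewrite -INR_muln -INR_addn; apply: leq_INR.
have ek : INR k = (INR k.-1 + 1)%R by rewrite -S_INR prednK // ltnW.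
have h2 : (INR N + INR N / INR k.-1 <= INR x / INR k.-1 + 1)%R.
  apply: (Rmult_le_reg_r (INR k.-1)) => //.
  have -> : ((INR N + INR N / INR k.-1) * INR k.-1 = INR N * INR k)%R by rewrite ek; field; lra.
  by have -> : ((INR x / INR k.-1 + 1) * INR k.-1 = INR x + INR k.-1)%R by field; lra.
rewrite S_INR.
have -> : (INR N * class_const k + class_const k * (INR N / INR k.-1 + INR j)
   = class_const k * (INR N + INR N / INR k.-1 + INR j))%R by ring.
by apply: Rmult_le_compat_l => //; lra.
Qed.
End ThetaClass.

(** * Chebyshev's lower bound *)

Lemma ln_le_sub1 x : (0 < x)%R -> (ln x <= x - 1)%R.
Proof.
move=> x0; have := exp_ineq1_le (x - 1); have -> : (1 + (x - 1) = x)%R by ring.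
case=> [h|e]; last by have := ln_exp (x - 1); rewrite -e; lra.
by apply/Rlt_le; rewrite -[X in (_ < X)%R](ln_exp (x - 1)); apply: ln_increasing.
Qed.

Lemma ln_div x y : (0 < x)%R -> (0 < y)%R -> ln (x / y) = (ln x - ln y)%R.
Proof.
by move=> x0 y0; rewrite /Rdiv ln_mult ?ln_Rinv //; apply: Rinv_0_lt_compat.
Qed.

(** Both bounds are [ln y <= y - 1], at [y = (n + 1) / n] and at its inverse. *)
Lemma lnnS_sub n : 0 < n ->
  (INR n * (lnn n.+1 - lnn n) <= 1 <= INR n.+1 * (lnn n.+1 - lnn n))%R.
Proof.
move=> n0; have N0 := INR_gt0 n0; have N1 : (0 < INR n.+1)%R by apply: INR_gt0.
rewrite /lnn -ln_div //; split.
  have h := @ln_le_sub1 (INR n.+1 / INR n) (Rdiv_lt_0_compat _ _ N1 N0).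
  apply: Rle_trans (Rmult_le_compat_l _ _ _ (Rlt_le _ _ N0) h) _.
  by rewrite S_INR; apply: Req_le; field; lra.
have := @ln_le_sub1 (INR n / INR n.+1) (Rdiv_lt_0_compat _ _ N0 N1).
rewrite !ln_div // => h.
have := Rmult_le_compat_l _ _ _ (Rlt_le _ _ N1) h.
have -> : (INR n.+1 * (INR n / INR n.+1 - 1) = -1)%R by rewrite S_INR; field; rewrite -S_INR; lra.
lra.
Qed.

(** A weak Stirling formula, whose increments are controlled by [lnnS_sub]. *)
Lemma lnn_fact_bounds n : 0 < n ->
  (INR n * lnn n - INR n <= lnn n`! <= INR n * lnn n - INR n + lnn n + 1)%R.
Proof.
elim: n => // -[|n] IHn _; first by rewrite (_ : 1`! = 1) // lnn1 /=; lra.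
have [//|lo hi] := IHn; have [h1 h2] := @lnnS_sub n.+1 isT.
rewrite factS lnnM ?fact_gt0 //; move: h1 h2; rewrite (S_INR n.+1); lra.
Qed.

Lemma dvdn_logn_le a b : 0 < a -> 0 < b ->
  (forall p, prime p -> logn p a <= logn p b) -> a %| b.
Proof.
move=> a0 b0 h; apply/dvdn_partP => // p; rewrite mem_primes => /and3P[pp _ _].
by rewrite p_part pfactor_dvdn // h.
Qed.

(** A common summation range lets Legendre's sums for different factorials be compared term by
    term. *)
Lemma logn_fact_widen p n M : prime p -> n <= M ->
  logn p n`! = \sum_(1 <= i < M.+1) n %/ p ^ i.
Proof.
move=> pp nM; rewrite logn_fact // [in RHS](big_cat_nat _ (n := n.+1)) //=.
rewrite [X in _ = _ + X]big_nat_cond [X in _ = _ + X]big1 ?addn0 // => i.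
case/andP=> /andP[ni _] _; apply: divn_small.
by apply: leq_trans ni _; rewrite ltnW // ltn_expl // prime_gt1.
Qed.

(* With [e = 30n / p ^ i], the exponents compare because
   [e + e / 30 <= e / 2 + e / 3 + e / 5 + 1], the last term being needed only
   when [p ^ i <= 30n]. *)
Lemma chebyshev_dvd n : 0 < n ->
  (30 * n)`! * n`! %| (15 * n)`! * (10 * n)`! * (6 * n)`! *
    \prod_(0 <= p < (30 * n).+1 | prime p) p ^ trunc_log p (30 * n).
Proof.
move=> n0; set M := 30 * n; set D := \prod_(_ <= _ < _ | _) _.
have D0 : 0 < D by apply: prodn_cond_gt0 => p /prime_gt0 p0; rewrite expn_gt0 p0.
apply: dvdn_logn_le; rewrite ?muln_gt0 ?fact_gt0 // => p pp.
rewrite !lognM ?muln_gt0 ?fact_gt0 //.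
have [pM|Mp] := leqP p M; last first.
  have z m : m <= M -> logn p m`! = 0.
    move=> mM; rewrite (logn_fact_widen pp (leqnn m)) big_nat_cond big1 // => i.
    case/andP=> /andP[i0 _] _; apply: divn_small; apply: leq_ltn_trans mM (leq_trans Mp _).
    by rewrite -{1}(expn1 p) leq_exp2l // prime_gt1.
  by rewrite !z //; lia.
have tD : trunc_log p M <= logn p D.
  rewrite -pfactor_dvdn // /D big_mkcond (bigD1_seq p) ?iota_uniq ?mem_index_iota ?ltnS //=.
  by rewrite pp dvdn_mulr.
apply: leq_trans (leq_add (leqnn _) tD).
rewrite !(@logn_fact_widen p _ M) //; try lia.
(* The extra [1] is spent only on the exponents [i <= trunc_log p M], and [D] pays for exactly that
   many. *)
have ht : \sum_(1 <= i < M.+1) (i <= trunc_log p M) <= trunc_log p M.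
  suff h K : \sum_(1 <= i < K.+1) (i <= trunc_log p M) <= minn K (trunc_log p M).
    exact: leq_trans (h M) (geq_minr _ _).
  by elim: K => [|K IHK]; [rewrite big_geq | rewrite big_nat_recr //=; lia].
apply: leq_trans (leq_add (leqnn _) ht).
rewrite -!big_split /=; apply: leq_sum => i _.
set e := M %/ p ^ i.
have p0 : 0 < p ^ i by rewrite expn_gt0 prime_gt0.
(* Nested floor divisions commute, so every quotient becomes a function of [e]. *)
have -> : n %/ p ^ i = e %/ 30 by rewrite /e divnAC; congr (_ %/ _); lia.
have -> : (15 * n) %/ p ^ i = e %/ 2 by rewrite /e divnAC; congr (_ %/ _); lia.
have -> : (10 * n) %/ p ^ i = e %/ 3 by rewrite /e divnAC; congr (_ %/ _); lia.
have -> : (6 * n) %/ p ^ i = e %/ 5 by rewrite /e divnAC; congr (_ %/ _); lia.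
have [it|ti] := leqP i (trunc_log p M); first lia.
suff -> : e = 0 by [].
apply: divn_small; apply: leq_trans (trunc_log_ltn _ (prime_gt1 pp)) _.
by rewrite leq_exp2l // prime_gt1.
Qed.

Lemma count_primes_le s r : uniq r ->
  count (fun p => prime p && (p <= s)) r <= (s.+1)./2.+1.
Proof.
move=> ur; rewrite -size_filter.
have -> : (s.+1)./2.+1 = size (2 :: [seq i.*2.+1 | i <- iota 0 (s.+1)./2]).
  by rewrite /= size_map size_iota.
apply: uniq_leq_size => [|p]; first exact: filter_uniq.
rewrite mem_filter => /andP[/andP[pp ps] _]; rewrite inE.
case: (even_prime pp) => [->|po]; first by rewrite eqxx.
apply/orP; right; apply/mapP; exists p./2; first by rewrite mem_iota; lia.
by lia.
Qed.

Lemma rsum_const (I : Type) (r : seq I) (P : pred I) c :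
  (\rsum_(i <- r | P i) c = INR (count P r) * c)%R.
Proof.
elim: r => [|i r IHr]; first by rewrite big_nil /=; ring.
rewrite big_cons /= INR_addn IHr; case: (P i) => /=; ring.
Qed.

(** Logarithms of [chebyshev_dvd]: since [30 + 1 = 15 + 10 + 6], the terms in [n * lnn n] and in [n]
    cancel and only the logarithms of 2, 3, 5 remain. By [30 * n < s.+1 ^ 2], primes above [s] enter
    with exponent at most 1; the at most [s / 2 + 2] others cost [lnn (30 * n)] each, and the three
    upper Stirling bounds cost three more such terms and the final [3]. *)
Lemma chebyshev_theta_ge n s : 0 < n -> 30 * n < s.+1 ^ 2 ->
  (INR n * (14 * lnn 2 + 9 * lnn 3 + 5 * lnn 5)
    <= theta s (30 * n) predT + (INR s / 2 + 5) * lnn (30 * n) + 3)%R.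
Proof.
move=> n0 ns; set x := 30 * n.
have x0 : 0 < x by rewrite muln_gt0.
have := dvdn_leq _ (chebyshev_dvd n0); rewrite !muln_gt0 !fact_gt0 /=.
set D := \prod_(_ <= _ < _ | _) _.
have D0 : 0 < D by apply: prodn_cond_gt0 => p /prime_gt0 p0; rewrite expn_gt0 p0.
move/(_ D0) => le; have := lnn_le _ le; rewrite !muln_gt0 !fact_gt0 => /(_ isT).
rewrite !lnnM ?muln_gt0 ?fact_gt0 // -/x.
have lx0 := lnn_ge0 x.
have lD : (lnn D <= theta s x predT + (INR s / 2 + 2) * lnn x)%R.
  rewrite /D lnn_prod; last by move=> p /prime_gt0 p0; rewrite expn_gt0 p0.
  rewrite (bigID (fun p => p <= s)) /= Rplus_comm.
  apply: Rplus_le_compat.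
    apply: Rle_trans (rsum_le _) (rsum_le_cond _ lnn_ge0) => [p|p _].
      rewrite -ltnNge => _ /andP[pp sp]; rewrite lnnX ?prime_gt0 //.
      rewrite -[X in (_ <= X)%R]Rmult_1_l; apply: Rmult_le_compat_r; first exact: lnn_ge0.
      rewrite -[X in (_ <= X)%R]/(INR 1); apply: leq_INR; rewrite leqNgt; apply: contraL ns => t2; rewrite -leqNgt.
      apply: leq_trans (trunc_logP (prime_gt1 pp) x0).
      apply: (@leq_trans (p ^ 2)); first by rewrite leq_exp2r.
      by rewrite leq_exp2l // prime_gt1.
    by rewrite -ltnNge => /andP[-> ->].
  apply: (@Rle_trans _ (\rsum_(0 <= p < x.+1 | prime p && (p <= s)%N) lnn x)).
    apply: rsum_le => p _ /andP[pp _]; apply: lnn_le; first by rewrite expn_gt0 prime_gt0.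
    exact: trunc_logP (prime_gt1 pp) x0.
  rewrite rsum_const; apply: Rmult_le_compat_r => //.
  have := count_primes_le s (iota_uniq 0 (x.+1 - 0)).
  rewrite -/(index_iota 0 x.+1); set c := count _ _ => cs.
  have : 2 * c <= s + 3 by lia.
  by move/leq_INR; rewrite INR_muln INR_addn /=; lra.
have fb c : 0 < c -> (IZR (Z.of_nat c) * INR n * (lnn c + lnn n) - IZR (Z.of_nat c) * INR n
    <= lnn (c * n)`! <= IZR (Z.of_nat c) * INR n * (lnn c + lnn n)
        - IZR (Z.of_nat c) * INR n + (lnn c + lnn n) + 1)%R.
  move=> c0; have := @lnn_fact_bounds (c * n).
  by rewrite muln_gt0 c0 n0 INR_muln lnnM // INR_IZR_INZ; apply.
have [lo30 _] := fb 30 isT; have [lo1 _] := lnn_fact_bounds n0.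
have [_ up15] := fb 15 isT; have [_ up10] := fb 10 isT; have [_ up6] := fb 6 isT.
have e30 : lnn 30 = (lnn 2 + lnn 3 + lnn 5)%R by rewrite -!lnnM.
have e15 : lnn 15 = (lnn 3 + lnn 5)%R by rewrite -!lnnM.
have e10 : lnn 10 = (lnn 2 + lnn 5)%R by rewrite -!lnnM.
have e6 : lnn 6 = (lnn 2 + lnn 3)%R by rewrite -!lnnM.
have ex : lnn x = (lnn 2 + lnn 3 + lnn 5 + lnn n)%R by rewrite -e30 -lnnM.
have l2 := lnn_ge0 2; have l3 := lnn_ge0 3; have l5 := lnn_ge0 5.
rewrite ex in lx0 lD *; rewrite e30 /= in lo30; rewrite e15 /= in up15.
rewrite e10 /= in up10; rewrite e6 /= in up6.
move: lo30 lo1 up15 up10 up6 lD; rewrite -/x.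
move: (lnn x`!) (lnn n`!) (lnn (15 * n)`!) (lnn (10 * n)`!) (lnn (6 * n)`!) (lnn D).
move: l2 l3 l5; rewrite e30; clear; move=> *; lra.
Qed.

(** * Numerical constants *)

Lemma class_constM a b : coprime a b -> 0 < a -> 0 < b ->
  class_const (a * b) = (class_const a + class_const b)%R.
Proof.
move=> cab a0 b0; rewrite /class_const lnnM //.
have -> : \rsum_(p <- primes (a * b)) (lnn p / INR p.-1)
   = \rsum_(p <- primes a ++ primes b) (lnn p / INR p.-1).
  apply: perm_big; apply: uniq_perm; first exact: primes_uniq.
    by rewrite cat_uniq !primes_uniq andbT /= -coprime_has_primes.
  by move=> p; rewrite mem_cat primesM.
by rewrite big_cat /=; ring.
Qed.

Lemma class_constX p e : prime p ->
  class_const (p ^ e.+1) = (INR e.+1 * lnn p + lnn p / INR p.-1)%R.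
Proof.
by move=> pp; rewrite /class_const lnnX ?prime_gt0 // primesX // primes_prime // big_seq1.
Qed.

Lemma class_const_prime p : prime p ->
  class_const p = (lnn p + lnn p / INR p.-1)%R.
Proof. by move=> pp; rewrite -[p in LHS]expn1 class_constX //= Rmult_1_l. Qed.

Lemma class_const2 : class_const 2 = (2 * lnn 2)%R.
Proof. by rewrite class_const_prime //= ; field. Qed.

(** * Union bounds for theta *)

Lemma theta_or s x (P Q : pred nat) :
  (theta s x (fun p => P p || Q p) <= theta s x P + theta s x Q)%R.
Proof.
rewrite /theta !(big_mkcond (fun p => [&& _, _ & _])) -big_split /=.
apply: rsum_le => p _ _; have := lnn_ge0 p.
by case: (s < p)%N; case: (prime p); case: (P p); case: (Q p) => /=; lra.
Qed.

Lemma theta_sub s x (P Q : pred nat) :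
  (forall p, s < p <= x -> prime p -> P p -> Q p) ->
  (theta s x P <= theta s x Q)%R.
Proof.
move=> h; apply: rsum_le_cond lnn_ge0 => p; rewrite mem_index_iota => /andP[_ px].
by case/and3P=> sp pp Pp; rewrite sp pp h // sp.
Qed.

Lemma theta_has s x (I : Type) (r : seq I) (P : I -> pred nat) :
  (theta s x (fun p => has (fun i => P i p) r) <= \rsum_(i <- r) theta s x (P i))%R.
Proof.
elim: r => [|i r IHr].
  rewrite big_nil /theta big_pred0; first exact: Rle_refl.
  by move=> p; rewrite !andbF.
rewrite big_cons; apply: Rle_trans (theta_or _ _ _ _) _.
exact: Rplus_le_compat_l.
Qed.

Lemma theta_pred1_le s x q : (theta s x (pred1 q) <= lnn q)%R.
Proof.
rewrite /theta; apply: (@Rle_trans _ (\rsum_(0 <= p < x.+1 | pred1 q p) lnn q)).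
  apply: Rle_trans (rsum_le_cond _ lnn_ge0) (rsum_le _) => [p _ /and3P[_ _] // |p _ /eqP ->].
  exact: Rle_refl.
rewrite rsum_const -[X in (_ <= X)%R]Rmult_1_l.
apply: Rmult_le_compat_r; first exact: lnn_ge0.
rewrite -[X in (_ <= X)%R]/(INR 1); apply: leq_INR.
by rewrite count_uniq_mem ?iota_uniq // leq_b1.
Qed.

(* [w] carries the residue classes that the primes already lie in. *)
Lemma theta_mod_class_le s x j w d (P : pred nat) : 1 < w * d ->
  coprime w d -> x <= s * 2 ^ j ->
  (forall p, s < p -> prime p -> P p -> coprime p (w * d)) ->
  (forall p p', s < p -> prime p -> P p -> s < p' -> prime p' -> P p' ->
     p = p' %[mod w]) ->
  (forall p p', s < p -> prime p -> P p -> s < p' -> prime p' -> P p' ->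
     p = p' %[mod d]) ->
  (theta s x P <= class_const (w * d) * (INR x / INR (w * d).-1 + INR j))%R.
Proof.
move=> wd1 cwd xs hc hw hd; apply: theta_class_le => // p p' sp pp Pp sp' pp' Pp'.
by apply/eqP; rewrite chinese_remainder // (hw p p') // (hd p p') // !eqxx.
Qed.

(** The inequality [ln y <= y - 1] is sharp near 1; [0.9946] and [1.00544] lie just above the 128th
    roots of [1 / 2] and [2]. *)
Lemma ln2_bounds : (0.6912 <= lnn 2 <= 0.6964)%R.
Proof.
have e2 : INR 2 = 2%R by rewrite /=; lra.
rewrite /lnn e2; split.
  have h : (/ 2 <= 0.9946 ^ 128)%R by lra.
  have := ln_le_sub1 (_ : 0 < 0.9946)%R; have pos : (0 < 0.9946)%R by lra.
  move=> /(_ pos) l; have p2 : (0 < / 2)%R by lra.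
  have : (ln (/ 2) <= ln (0.9946 ^ 128))%R.
    by case: h => [h|->]; [apply/Rlt_le/ln_increasing | apply: Rle_refl].
  by rewrite ln_Rinv ?ln_pow //; [rewrite INR_IZR_INZ /=; lra | lra].
have h : (2 <= 1.00544 ^ 128)%R by lra.
have pos : (0 < 1.00544)%R by lra.
have l := ln_le_sub1 pos; have p2 : (0 < 2)%R by lra.
have : (ln 2 <= ln (1.00544 ^ 128))%R.
  by case: h => [h|<-]; [apply/Rlt_le/ln_increasing | apply: Rle_refl].
by rewrite ln_pow // INR_IZR_INZ /=; lra.
Qed.

(** The powers are compared in [Z], where binary arithmetic decides concrete instances quickly. *)
Lemma lnn_pow_le a b e f : 0 < a -> 0 < b ->
  (Z.of_nat a ^ Z.of_nat e <=? Z.of_nat b ^ Z.of_nat f)%Z ->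
  (INR e * lnn a <= INR f * lnn b)%R.
Proof.
move=> a0 b0 h; rewrite -!lnnX //; apply: lnn_le; first by rewrite expn_gt0 a0.
have : (Z.of_nat (a ^ e) <= Z.of_nat (b ^ f))%Z by move: h; lia.
by lia.
Qed.

(** Rational approximations of base-2 logarithms, certified by comparisons such as
    [2 ^ 84 <= 3 ^ 53]; they make later estimates linear in [lnn 2]. *)
Lemma prime_log_bounds :
  [/\ (84 / 53 * lnn 2 <= lnn 3 <= 65 / 41 * lnn 2)%R,
      (65 / 28 * lnn 2 <= lnn 5 <= 72 / 31 * lnn 2)%R,
      (lnn 7 <= 73 / 26 * lnn 2)%R,
      (lnn 11 <= 45 / 13 * lnn 2)%R & (lnn 13 <= 100 / 27 * lnn 2)%R].
Proof.
have h a b e f : 0 < a -> 0 < b ->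
    (Z.of_nat a ^ Z.of_nat e <=? Z.of_nat b ^ Z.of_nat f)%Z ->
    (IZR (Z.of_nat e) * lnn a <= IZR (Z.of_nat f) * lnn b)%R.
  by move=> a0 b0 c; rewrite -!INR_IZR_INZ; apply: lnn_pow_le.
have := @h 2 3 84 53 isT isT isT; have := @h 3 2 41 65 isT isT isT.
have := @h 2 5 65 28 isT isT isT; have := @h 5 2 31 72 isT isT isT.
have := @h 7 2 26 73 isT isT isT; have := @h 11 2 13 45 isT isT isT.
have := @h 13 2 27 100 isT isT isT => /=.
by move=> *; do ?split; lra.
Qed.

(* [tail_const n - tail_const n.+2] dominates the contribution of [r = n.+1], so
   the contributions of all odd [r > 16] telescope to at most [tail_const 16]. *)
Definition tail_const (n : nat) : R := ((33 / 64 * lnn n + 897 / 1000) / INR n)%R.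

Lemma tail_term_le n : 16 <= n ->
  ((2 * lnn 2 + 33 / 16 * lnn n.+1) / (2 * INR n.+1 ^ 2 - 1)
    <= tail_const n - tail_const n.+2)%R.
Proof.
move=> n16; have n0 : 0 < n by lia.
have [u _] := lnnS_sub n0; have [v _] := @lnnS_sub n.+1 isT.
have a16 : (16 <= INR n)%R by have := leq_INR n16; rewrite INR_IZR_INZ.
have [_ l2] := ln2_bounds; have l2' := lnn_ge0 2.
rewrite /tail_const; move: u v; rewrite !S_INR.
have := lnn_ge0 n.+1; move: (lnn n) (lnn n.+1) (lnn n.+2) => L R M.
move: (INR n) a16 => a a16 R0 u v.
(* With [a2] this bounds the bracket below by [17 / 8]; the constant [897 / 1000] of [tail_const] is
   large enough that [lnn 2 + 33 / 64 * (17 / 8) <= 897 / 500]. *)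
have a1 : (a * (R - L) + 2 * (R - L) <= 1 + 1/8)%R.
  have : (16 * (R - L) <= 1)%R.
    have [h|h] := Rle_lt_dec 0 (R - L); last lra.
    by apply: Rle_trans u; apply: Rmult_le_compat_r.
  lra.
have a2 : (a * (M - R) <= 1)%R.
  have [h|h] := Rle_lt_dec 0 (M - R); first lra.
  by apply: (@Rle_trans _ 0); [nra | lra].
have den : (0 < a * (a + 2))%R by nra.
have den2 : (0 < 2 * (a + 1) ^ 2 - 1)%R by nra.
have -> : ((33 / 64 * L + 897 / 1000) / a - (33 / 64 * M + 897 / 1000) / (a + 1 + 1)
  = (897 / 500 + 33 / 32 * R - 33 / 64 * ((a + 2) * (R - L) + a * (M - R))) / (a * (a + 2)))%R.
  by field; lra.
(* Here [2 * (a * (a + 2)) = 2 * (a + 1) ^ 2 - 2] is smaller than the original denominator. *)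
apply: (@Rle_trans _ ((lnn 2 + 33 / 32 * R) / (a * (a + 2)))).
  apply: (Rmult_le_reg_r (2 * (a + 1) ^ 2 - 1)) => //.
  apply: (Rmult_le_reg_r (a * (a + 2))) => //.
  have -> : ((2 * lnn 2 + 33 / 16 * R) / (2 * (a + 1) ^ 2 - 1) * (2 * (a + 1) ^ 2 - 1) * (a * (a + 2))
    = (2 * lnn 2 + 33 / 16 * R) * (a * (a + 2)))%R by field; lra.
  have -> : ((lnn 2 + 33 / 32 * R) / (a * (a + 2)) * (2 * (a + 1) ^ 2 - 1) * (a * (a + 2))
    = (lnn 2 + 33 / 32 * R) * (2 * (a + 1) ^ 2 - 1))%R by field; lra.
  nra.
apply: Rmult_le_compat_r; first exact/Rlt_le/Rinv_0_lt_compat.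
lra.
Qed.

Lemma tail_sum_le n : 16 <= n ->
  (\rsum_(17 <= r < n.+1 | odd r)
     ((2 * lnn 2 + 33 / 16 * lnn r) / (2 * INR r ^ 2 - 1)) <= tail_const 16)%R.
Proof.
move=> n16.
(* Telescoping moves in steps of 2 and stops at the largest even number up to [n + 1]. *)
suff h : (\rsum_(17 <= r < n.+1 | odd r)
     ((2 * lnn 2 + 33 / 16 * lnn r) / (2 * INR r ^ 2 - 1))
     <= tail_const 16 - tail_const (n.+1)./2.*2)%R.
  apply: Rle_trans h _.
  suff : (0 <= tail_const (n.+1)./2.*2)%R by lra.
  have p : (0 < INR (n.+1)./2.*2)%R by apply: INR_gt0; lia.
  apply: Rmult_le_pos; last exact/Rlt_le/Rinv_0_lt_compat.
  by have := lnn_ge0 (n.+1)./2.*2; lra.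
rewrite -(subnK n16); elim: (n - 16) => [|k IHk].
  by rewrite add0n big_geq // (_ : (17)./2.*2 = 16) //; lra.
rewrite addSn big_mkcond big_nat_recr /=; last by lia.
rewrite -big_mkcond; set N := k + 16 in IHk *.
have N16 : 16 <= N by apply: leq_addl.
case: ifP => [oN | /negbT oN].
  have e1 : (N.+1)./2.*2 = N by move: oN; clear; lia.
  have e2 : (N.+2)./2.*2 = N.+2 by move: oN; clear; lia.
  move: IHk; rewrite e1 e2 => IHk.
  apply: Rle_trans (Rplus_le_compat _ _ _ _ IHk (tail_term_le N16)) _.
  by apply: Req_le; ring.
have -> : (N.+2)./2.*2 = (N.+1)./2.*2 by move: oN; clear; lia.
by rewrite Rplus_0_r.
Qed.

Lemma count_odd_iota a k : count odd (iota a k) = (k + odd a)./2.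
Proof.
elim: k a => [|k IHk] a; first by case: (odd a).
by rewrite /= IHk /=; case: (odd a) => /=; lia.
Qed.

(* [p < m] excludes the junk value [m - p = 0]. *)
Definition sq_bad (m r : nat) : pred nat := fun p => (p < m) && (r ^ 2 %| m - p).

Lemma sq_bad_mod m r p : sq_bad m r p -> p = m %[mod r ^ 2].
Proof. by case/andP=> pm d; apply/esym/eqP; rewrite eqn_mod_dvd // ltnW. Qed.

Lemma prime_gt_coprime s r p : s < p -> prime p -> prime r -> r <= s -> coprime p r.
Proof. by move=> sp pp pr rs; rewrite prime_coprime // dvdn_prime2 //; apply/eqP; lia. Qed.

(** * Theta over the bad primes above the cutoff *)

Section PrimesAboveRoot.
Variables (s x j m : nat).
Hypothesis s_ge3 : 3 <= s.
Hypothesis xs : x <= s * 2 ^ j.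

Lemma prime_mod2 p : s < p -> prime p -> p = 1 %[mod 2].
Proof. by move=> sp pp; rewrite modn2; case: (even_prime pp) => [|->]; lia. Qed.

Lemma prime_coprime2 p : s < p -> prime p -> coprime p 2.
Proof. by move=> sp pp; apply: (prime_gt_coprime sp pp) => //; lia. Qed.

(** Primes above [s] are odd and differ from [r], so the bad ones lie in a single class modulo
    [2 * r ^ 2], prime to it. *)
Lemma theta_sq_bad_le r : prime r -> odd r -> r <= s ->
  (theta s x (sq_bad m r) <= (2 * lnn 2 + 2 * lnn r + lnn r / INR r.-1)
     * (INR x / (2 * INR r ^ 2 - 1) + INR j))%R.
Proof.
move=> pr ro rs; have r1 := prime_gt1 pr.
have c2 : coprime 2 (r ^ 2) by rewrite coprimeXr // coprime2n.
have := @theta_mod_class_le s x j 2 (r ^ 2) (sq_bad m r).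
have -> : INR (2 * r ^ 2).-1 = (2 * INR r ^ 2 - 1)%R.
  have : 0 < 2 * r ^ 2 by rewrite muln_gt0 expn_gt0 (prime_gt0 pr).
  move=> h; have : INR (2 * r ^ 2).-1.+1 = INR (2 * r ^ 2) by rewrite prednK.
  by rewrite S_INR -mulnn !INR_muln /=; lra.
rewrite class_constM ?expn_gt0 ?prime_gt0 // class_const2 class_constX //=.
rewrite Rplus_assoc; apply => //.
- by rewrite -mulnn; nia.
- move=> p sp pp _; rewrite coprimeMr prime_coprime2 // coprimeXr //.
  exact: prime_gt_coprime pp pr rs.
- by move=> p p' sp pp _ sp' pp' _; rewrite (prime_mod2 sp pp) (prime_mod2 sp' pp').
by move=> p p' _ _ /sq_bad_mod -> _ _ /sq_bad_mod ->.
Qed.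

(** Modulo 3, [p] avoids [0] and the nonzero residue of [m], so one class is left and the modulus
    grows to [6 * r ^ 2]. *)
Lemma theta_sq_bad3_le r : prime r -> odd r -> r != 3 -> r <= s -> ~~ (3 %| m) ->
  (theta s x (fun p => sq_bad m r p && ~~ (3 %| m - p))
    <= (2 * lnn 2 + 3 / 2 * lnn 3 + 2 * lnn r + lnn r / INR r.-1)
     * (INR x / (6 * INR r ^ 2 - 1) + INR j))%R.
Proof.
move=> pr ro r3 rs m3; have r1 := prime_gt1 pr.
have c2 : coprime 2 (r ^ 2) by rewrite coprimeXr // coprime2n.
have c3 : coprime 3 (r ^ 2).
  by rewrite coprimeXr // prime_coprime // dvdn_prime2 // eq_sym.
have c6 : coprime (2 * 3) (r ^ 2) by rewrite coprimeMl c2 c3.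
have := @theta_mod_class_le s x j (2 * 3) (r ^ 2) (fun p => sq_bad m r p && ~~ (3 %| m - p)).
have -> : INR (2 * 3 * r ^ 2).-1 = (6 * INR r ^ 2 - 1)%R.
  have : 0 < 2 * 3 * r ^ 2 by rewrite muln_gt0 expn_gt0 (prime_gt0 pr).
  move=> h; have : INR (2 * 3 * r ^ 2).-1.+1 = INR (2 * 3 * r ^ 2) by rewrite prednK.
  by rewrite S_INR -mulnn !INR_muln /=; lra.
rewrite (class_constM c6) ?expn_gt0 ?(ltnW r1) // (@class_constM 2 3) // class_const2.
rewrite class_const_prime // class_constX //=.
have -> : (2 * lnn 2 + (lnn 3 + lnn 3 / (1 + 1)) + ((1 + 1) * lnn r + lnn r / INR r.-1)
  = 2 * lnn 2 + 3 / 2 * lnn 3 + 2 * lnn r + lnn r / INR r.-1)%R by lra.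
apply => //.
- by rewrite -mulnn; nia.
- move=> p sp pp _; have cr := prime_gt_coprime sp pp pr rs.
  by rewrite (coprimeMr p (2 * 3)) (coprimeMr p 2) prime_coprime2 ?coprimeXr ?(prime_gt_coprime sp pp).
- move=> p p' sp pp /andP[/andP[pm _] h] sp' pp' /andP[/andP[pm' _] h'].
  apply/eqP; rewrite chinese_remainder //.
  rewrite (prime_mod2 sp pp) (prime_mod2 sp' pp') eqxx /=.
  have := prime_gt_coprime sp pp (isT : prime 3) s_ge3.
  have := prime_gt_coprime sp' pp' (isT : prime 3) s_ge3.
  rewrite ![coprime _ 3]coprime_sym !prime_coprime //.
  by move: h h' m3 pm pm'; clear; lia.
by move=> p p' _ _ /andP[/sq_bad_mod -> _] _ _ /andP[/sq_bad_mod -> _].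
Qed.

(** As [q] may exceed [s], the prime [p = q] is set aside to keep the class prime to [2 * q]. *)
Lemma theta_dvd_le q : prime q -> odd q ->
  (theta s x (fun p => [&& (p < m)%N, q %| m - p & p != q])
    <= (2 * lnn 2 + lnn q + lnn q / INR q.-1)
     * (INR x / (2 * INR q - 1) + INR j))%R.
Proof.
move=> pq qo; have q1 := prime_gt1 pq.
have c2 : coprime 2 q by rewrite coprime2n.
have := @theta_mod_class_le s x j 2 q (fun p => [&& (p < m)%N, q %| m - p & p != q]).
have -> : INR (2 * q).-1 = (2 * INR q - 1)%R.
  have : 0 < 2 * q by rewrite muln_gt0 (prime_gt0 pq).
  move=> h; have : INR (2 * q).-1.+1 = INR (2 * q) by rewrite prednK.
  by rewrite S_INR INR_muln /=; lra.
rewrite class_constM ?prime_gt0 // class_const2 class_const_prime //=.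
rewrite Rplus_assoc; apply => //.
- by nia.
- move=> p sp pp /and3P[_ _ pnq]; rewrite coprimeMr prime_coprime2 //.
  by rewrite prime_coprime // dvdn_prime2.
- by move=> p p' sp pp _ sp' pp' _; rewrite (prime_mod2 sp pp) (prime_mod2 sp' pp').
move=> p p' _ _ /and3P[pm d _] _ _ /and3P[pm' d' _].
have e y : y < m -> q %| m - y -> y = m %[mod q].
  by move=> ym dy; apply/esym/eqP; rewrite eqn_mod_dvd // ltnW.
by rewrite (e p) // (e p').
Qed.

(** For [r >= 17], [lnn r / (r - 1)] is at most [lnn r / 16], whence the factor [33 / 16]. Primes
    are relaxed to odd numbers: the terms in [x] telescope, and at most [s / 2] terms in [j] occur,
    each bounded through [lnn s]. *)
Lemma theta_sq_bad_tail_le : 16 <= s ->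
  (\rsum_(r <- [seq r <- index_iota 17 s.+1 | prime r]) theta s x (sq_bad m r)
     <= INR x * tail_const 16
        + INR j * (INR s / 2 * (2 * lnn 2 + 33 / 16 * lnn s)))%R.
Proof.
move=> s16; rewrite big_filter.
have x0 : (0 <= INR x)%R by apply: pos_INR.
have j0 : (0 <= INR j)%R by apply: pos_INR.
have l2 := lnn_ge0 2.
pose f r := ((2 * lnn 2 + 33 / 16 * lnn r) / (2 * INR r ^ 2 - 1))%R.
pose c := (INR j * (2 * lnn 2 + 33 / 16 * lnn s))%R.
have ls := lnn_ge0 s.
have c0 : (0 <= c)%R by apply: Rmult_le_pos => //; lra.
have bnd r : r \in index_iota 17 s.+1 -> prime r ->
    (theta s x (sq_bad m r) <= INR x * f r + c)%R.
  rewrite mem_index_iota => /andP[r17 rs] pr.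
  have ro : odd r by case: (even_prime pr) => // r2; move: r17; rewrite r2.
  apply: Rle_trans (theta_sq_bad_le pr ro _) _; first by rewrite -ltnS.
  have lr := lnn_ge0 r.
  have r17' : (17 <= INR r)%R by have := leq_INR r17; rewrite INR_IZR_INZ.
  have r16 : (16 <= INR r.-1)%R.
    have : INR r.-1.+1 = INR r by rewrite prednK // prime_gt0.
    by rewrite S_INR; lra.
  have lq : (lnn r / INR r.-1 <= 1 / 16 * lnn r)%R.
    rewrite /Rdiv Rmult_1_l [X in (_ <= X)%R]Rmult_comm.
    by apply: Rmult_le_compat_l => //; apply: Rinv_le_contravar; lra.
  have lrs : (lnn r <= lnn s)%R by apply: lnn_le; lia.
  have d0 : (0 < 2 * INR r ^ 2 - 1)%R by nra.
  have xd : (0 <= INR x / (2 * INR r ^ 2 - 1))%R.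
    by apply: Rmult_le_pos => //; apply/Rlt_le/Rinv_0_lt_compat.
  apply: (@Rle_trans _ ((2 * lnn 2 + 33 / 16 * lnn r) * (INR x / (2 * INR r ^ 2 - 1) + INR j))).
    by apply: Rmult_le_compat_r; lra.
  rewrite Rmult_plus_distr_l; apply: Rplus_le_compat.
    by apply: Req_le; rewrite /f; field; lra.
  by rewrite Rmult_comm; apply: Rmult_le_compat_l => //; lra.
apply: Rle_trans (rsum_le bnd) _.
apply: (@Rle_trans _ (\rsum_(17 <= r < s.+1 | odd r) (INR x * f r + c))).
  rewrite big_mkcond [X in (_ <= X)%R]big_mkcond /=; apply: rsum_le => r.
  rewrite mem_index_iota => /andP[r17 rs] _.
  have f0 : (0 <= INR x * f r + c)%R.
    apply: Rplus_le_le_0_compat => //; apply: Rmult_le_pos => //.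
    have r17' : (17 <= INR r)%R by have := leq_INR r17; rewrite INR_IZR_INZ.
    apply: Rmult_le_pos; first by have := lnn_ge0 r; lra.
    by apply/Rlt_le/Rinv_0_lt_compat; nra.
  case pr: (prime r); last by case: ifP => // _; apply: Rle_refl.
  have -> : odd r by case: (even_prime pr) => // r2; move: r17; rewrite r2.
  exact: Rle_refl.
rewrite big_split /= rsum_distrr rsum_const; apply: Rplus_le_compat.
  by apply: Rmult_le_compat_l => //; apply: tail_sum_le.
have -> : (INR j * (INR s / 2 * (2 * lnn 2 + 33 / 16 * lnn s)) = INR s / 2 * c)%R.
  by rewrite /c; ring.
apply: Rmult_le_compat_r => //.
have : 2 * count odd (index_iota 17 s.+1) <= s by rewrite count_odd_iota /=; lia.
by move/leq_INR; rewrite INR_muln /=; lra.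
Qed.

End PrimesAboveRoot.

(* With [S = 4096 * w ^ 2 - 2], the bounds on [J] and [LM] are linear in [w], and
   all the error terms are dominated by [w ^ 4]. *)
Lemma final_numeric (S X J l2 LM : R) :
  (4096 <= S)%R -> (0.6912 <= l2 <= 0.6964)%R -> (0 <= J)%R ->
  (S * S - 30 <= X)%R -> (J * l2 <= l2 + LM)%R ->
  (LM <= 12 * l2 + ln ((S + 2) / 4096))%R -> (0 <= LM)%R ->
  (1.055 * l2 * X + 50 * l2 * J + 5 / 2 * LM * J + 2 * LM
    + X * ((33 / 64 * (4 * l2) + 897 / 1000) / 16)
    + J * (S / 2 * (2 * l2 + 33 / 16 * LM)) + (S / 2 + 5) * (2 * LM) + 3
   < X * (1.329 * l2))%R.
Proof.
move=> S0 [l2a l2b] J0 hX hJ hLM LM0.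
pose w := sqrt ((S + 2) / 4096).
have w2 : (w * w = (S + 2) / 4096)%R by apply: sqrt_sqrt; lra.
have w1 : (1 <= w)%R by rewrite -sqrt_1; apply: sqrt_le_1_alt; lra.
have w0 : (0 < w)%R by lra.
(* The number [8.3568] is [12 * 0.6964]; the rest follows from [ln w <= w - 1] and [w >= 1]. *)
have LMw : (LM <= 8.3568 * w)%R.
  move: hLM; rewrite -w2 ln_mult //; have := ln_le_sub1 w0; lra.
have Jw : (J <= 13 * w)%R.
  apply: (Rmult_le_reg_r l2); first lra.
  have h : (LM <= 12 * l2 + 2 * (w - 1))%R.
    move: hLM; rewrite -w2 ln_mult //; have := ln_le_sub1 w0; lra.
  nra.
have hS : (S <= 4096 * (w * w))%R by lra.
have ww1 : (1 <= w * w)%R by nra.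
have w21 : (w <= w * w)%R by nra.
have w31 : (w * w <= w * w * w)%R by nra.
have w41 : (w * w * w <= w * w * w * w)%R by nra.
set w4 := (w * w * w * w)%R in w41.
have t1 : (J * LM <= 13 * 8.3568 * (w * w))%R by nra.
have t2 : (J * S <= 13 * 4096 * (w * w * w))%R by nra.
have t3 : (J * S * LM <= 13 * 4096 * 8.3568 * w4)%R.
  rewrite /w4; have : (0 <= J * S)%R by nra.
  nra.
have t4 : (S * LM <= 4096 * 8.3568 * (w * w * w))%R by nra.
have t5 : (J * S * l2 <= 13 * 4096 * 0.6964 * (w * w * w))%R.
  have : (0 <= J * S)%R by nra.
  nra.
have t6 : (J * l2 <= 13 * 0.6964 * w)%R by nra.
have hX2 : (4096 * 4096 * w4 - 4 * 4096 * (w * w) - 26 <= X)%R.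
  have -> : (4096 * 4096 * w4 = (S + 2) * (S + 2))%R.
    by rewrite /w4; have -> : (S + 2 = 4096 * (w * w))%R by [lra]; ring.
  by lra.
have X0 : (0 <= X)%R by nra.
(* The net coefficient of [X] is [(1.329 - 1.055 - 33 / 256) * l2 - 0.897 / 16], which exceeds
   [0.0439] for [l2 >= 0.6912]. *)
have m : (0.0439 * X <= X * (1.329 * l2) - 1.055 * l2 * X
   - X * ((33 / 64 * (4 * l2) + 897 / 1000) / 16))%R.
  by nra.
lra.
Qed.

(** * Reduction to finding an uncovered prime *)

Definition odd_primes (q s : nat) : seq nat :=
  [seq r <- index_iota 3 s.+1 | prime r & r != q].

Definition covered (q s m : nat) : pred nat :=
  fun p => (q %| m - p) || has (fun r => sq_bad m r p) (odd_primes q s).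

(** A prime [r] with [r ^ 2] dividing [m - p] is odd by parity, at most [s] by size, and not [q]
    because [q] does not divide [m - p]; so it would be on the list. *)
Lemma not_covered q s m p : prime q -> ~~ odd m -> m < s.+1 ^ 2 ->
  odd p -> p < m -> ~~ covered q s m p -> square_free (m - p) /\ coprime (m - p) q.
Proof.
move=> pq me ms po pm; rewrite negb_or => /andP[nq nr].
have c : coprime (m - p) q by rewrite coprime_sym prime_coprime.
split=> //; split=> [|r pr]; first by rewrite subn_gt0.
apply/negP => rd; case/negP: nr; apply/hasP; exists r; last by rewrite /sq_bad pm.
have rs : r < s.+1.
  rewrite -(ltn_exp2r _ _ (isT : 0 < 2)); apply: leq_ltn_trans ms.
  by apply: leq_trans (dvdn_leq _ rd) (leq_subr _ _); rewrite subn_gt0.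
rewrite mem_filter pr mem_index_iota rs !andbT /=; apply/andP; split.
  by apply: contraNneq nq => <-; apply: dvdn_trans rd; apply: dvdn_exp.
case: (even_prime pr) => [r2|]; last by case: (r) pr => [|[|[|]]].
have : 2 %| m - p by apply: dvdn_trans rd; rewrite r2.
by rewrite dvdn2 oddB ?(ltnW pm) // (negbTE me) po.
Qed.

Lemma sqrt_exists m : exists s, s ^ 2 <= m < s.+1 ^ 2.
Proof.
elim: m => [|m [s /andP[h1 h2]]]; first by exists 0.
have [h|h] := ltnP m.+1 (s.+1 ^ 2); first by exists s; rewrite h andbT ltnW.
by exists s.+1; rewrite h /=; move: h1 h2 h; rewrite -!mulnn; nia.
Qed.

(** * Numerical bounds for the individual bad classes *)

Section SmallClasses.
Variables (s x j m : nat).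
Hypothesis s16 : 16 <= s.
Hypothesis xs : x <= s * 2 ^ j.

Let xj_ge0 (k : R) : (0 < k)%R -> (0 <= INR x / k + INR j)%R.
Proof.
move=> k0; have := pos_INR x; have := pos_INR j => j0 x0.
by apply: Rplus_le_le_0_compat => //; apply: Rmult_le_pos => //; apply/Rlt_le/Rinv_0_lt_compat.
Qed.

(** The coefficients are the class constants in units of [lnn 2], rounded up; the denominators are
    [2 * r ^ 2 - 1]. *)
Lemma theta_sq_bad_small :
  [/\ (theta s x (sq_bad m 3) <= 5.9635 * lnn 2 * (INR x / 17 + INR j))%R,
      (theta s x (sq_bad m 5) <= 7.226 * lnn 2 * (INR x / 49 + INR j))%R,
      (theta s x (sq_bad m 7) <= 8.084 * lnn 2 * (INR x / 97 + INR j))%R,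
      (theta s x (sq_bad m 11) <= 9.27 * lnn 2 * (INR x / 241 + INR j))%R &
      (theta s x (sq_bad m 13) <= 9.717 * lnn 2 * (INR x / 337 + INR j))%R].
Proof.
have [[l3a l3b] [l5a l5b] l7 l11 l13] := prime_log_bounds.
have [l2a l2b] := ln2_bounds.
have h r (c d : R) : prime r -> odd r -> r <= 16 -> (0 < d)%R ->
    (2 * IZR (Z.of_nat r) ^ 2 - 1 = d)%R ->
    (2 * lnn 2 + 2 * lnn r + lnn r / IZR (Z.of_nat r.-1) <= c * lnn 2)%R ->
    (theta s x (sq_bad m r) <= c * lnn 2 * (INR x / d + INR j))%R.
  move=> pr ro r16 d0 ed ec.
  apply: Rle_trans (@theta_sq_bad_le s x j m _ xs r pr ro _) _; try lia.
  rewrite (INR_IZR_INZ r) (INR_IZR_INZ r.-1) ed.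
  by apply: Rmult_le_compat_r => //; apply: xj_ge0.
by split; apply: h => //=; lra.
Qed.

Lemma theta_sq_bad3_small : ~~ (3 %| m) ->
  (theta s x (fun p => sq_bad m 5 p && ~~ (3 %| m - p))
     <= 9.604 * lnn 2 * (INR x / 149 + INR j))%R /\
  (theta s x (fun p => sq_bad m 7 p && ~~ (3 %| m - p))
     <= 10.462 * lnn 2 * (INR x / 293 + INR j))%R.
Proof.
move=> m3.
have [[l3a l3b] [l5a l5b] l7 l11 l13] := prime_log_bounds.
have [l2a l2b] := ln2_bounds.
have s3 : 3 <= s by lia.
split.
  have := @theta_sq_bad3_le s x j m s3 xs 5 isT isT isT _ m3.
  have -> : (6 * INR 5 ^ 2 - 1 = 149)%R by rewrite /=; lra.
  move=> h; apply: Rle_trans (h _) _; first by lia.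
  by apply: Rmult_le_compat_r; [apply: xj_ge0; lra | rewrite /=; lra].
have := @theta_sq_bad3_le s x j m s3 xs 7 isT isT isT _ m3.
have -> : (6 * INR 7 ^ 2 - 1 = 293)%R by rewrite /=; lra.
move=> h; apply: Rle_trans (h _) _; first by lia.
by apply: Rmult_le_compat_r; [apply: xj_ge0; lra | rewrite /=; lra].
Qed.

(** Union bound shaped for the case distinction on [q]: [P] gathers the classes needing special
    treatment, [L] the remaining small [r]. *)
Lemma theta_cover_le (L : seq nat) (P : pred nat) :
  (forall p, s < p <= x -> prime p -> [|| P p, has (fun r => sq_bad m r p) L
     | has (fun r => sq_bad m r p) [seq r <- index_iota 17 s.+1 | prime r]]) ->
  (theta s x predT <= theta s x P + \rsum_(r <- L) theta s x (sq_bad m r)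
     + (INR x * tail_const 16
        + INR j * (INR s / 2 * (2 * lnn 2 + 33 / 16 * lnn s))))%R.
Proof.
move=> h; have s3 : 3 <= s by lia.
apply: Rle_trans (theta_sub (Q := fun p => P p || (has (fun r => sq_bad m r p) L
     || has (fun r => sq_bad m r p) [seq r <- index_iota 17 s.+1 | prime r])) _) _.
  by move=> p sp pp _; apply: h.
apply: Rle_trans (theta_or _ _ _ _) _; rewrite Rplus_assoc; apply: Rplus_le_compat_l.
apply: Rle_trans (theta_or _ _ _ _) _; apply: Rplus_le_compat; first exact: theta_has.
by apply: Rle_trans (theta_has _ _ _ _) _; apply: theta_sq_bad_tail_le.
Qed.

(** The denominators 9 and 13 are [2 * q - 1] at [q = 5] and [q = 7]; the value at 7 serves for all
    larger [q]. *)
Lemma theta_dvd_small q : prime q -> odd q -> 5 <= q ->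
  (theta s x (fun p => [&& (p < m)%N, q %| m - p & p != q])
    <= (if q == 5%N then 4.904 / 9 else 5.2758 / 13) * lnn 2 * INR x
       + (2 * lnn 2 + 5 / 4 * lnn q) * INR j)%R.
Proof.
move=> pq qo q5; have s3 : 3 <= s by lia.
have [[l3a l3b] [l5a l5b] l7 l11 l13] := prime_log_bounds.
have [l2a l2b] := ln2_bounds.
have x0 := pos_INR x; have j0 := pos_INR j; have lq := lnn_ge0 q.
apply: Rle_trans (@theta_dvd_le s x j m s3 xs q pq qo) _.
have q5' : (5 <= INR q)%R by have := leq_INR q5; rewrite INR_IZR_INZ.
have eq1 : (INR q.-1 = INR q - 1)%R.
  have : INR q.-1.+1 = INR q by rewrite prednK // prime_gt0.
  by rewrite S_INR; lra.
rewrite eq1 Rmult_plus_distr_l; apply: Rplus_le_compat; last first.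
  apply: Rmult_le_compat_r => //.
  suff : (lnn q / (INR q - 1) <= 1 / 4 * lnn q)%R by lra.
  rewrite /Rdiv Rmult_1_l [X in (_ <= X)%R]Rmult_comm.
  by apply: Rmult_le_compat_l => //; apply: Rinv_le_contravar; lra.
rewrite /Rdiv -Rmult_assoc (Rmult_assoc _ (INR x)) (Rmult_comm (INR x)) -Rmult_assoc.
apply: Rmult_le_compat_r => //.
case: eqP => [->|qn5]; first by rewrite /=; lra.
have q7 : 7 <= q by move: qn5 q5 qo; clear; case: q => [|[|[|[|[|[|[|]]]]]]].
have q7' : (7 <= INR q)%R by have := leq_INR q7; rewrite INR_IZR_INZ.
(* The tangent of the logarithm at 7 makes the comparison with the value at [q = 7] polynomial in
   [q]. *)
have lq7 : (lnn q <= lnn 7 + (INR q - 7) / 7)%R.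
  have e7 : INR 7 = 7%R by rewrite /=; lra.
  have : (lnn q - lnn 7 <= INR q / 7 - 1)%R.
    rewrite /lnn e7 -ln_div; try lra.
    by apply: ln_le_sub1; apply: Rdiv_lt_0_compat; lra.
  by lra.
have d0 : (0 < 2 * INR q - 1)%R by lra.
apply: (Rmult_le_reg_r (2 * INR q - 1)) => //.
rewrite Rmult_assoc Rinv_l ?Rmult_1_r; last lra.
have h : (lnn q * / (INR q - 1) <= 1 / 6 * lnn q)%R.
  rewrite /Rdiv Rmult_1_l [X in (_ <= X)%R]Rmult_comm.
  by apply: Rmult_le_compat_l => //; apply: Rinv_le_contravar; lra.
nra.
Qed.

End SmallClasses.

Lemma covered_split q s m p : covered q s m p ->
  [|| q %| m - p,
      has (fun r => (r != q) && sq_bad m r p) [:: 3; 5; 7; 11; 13]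
    | has (fun r => sq_bad m r p) [seq r <- index_iota 17 s.+1 | prime r]].
Proof.
case/orP=> [-> //|/hasP[r]].
rewrite mem_filter mem_index_iota => /andP[/andP[pr rq] /andP[r3 rs]] b.
have [r17|r17] := leqP 17 r.
  apply/or3P/Or33/hasP; exists r => //.
  by rewrite mem_filter pr mem_index_iota r17.
apply/or3P/Or32/hasP; exists r; last by rewrite rq.
by move: pr r3 r17 {rq rs b}; do 17 (case: r => [//|r]).
Qed.

(** * Upper bound for theta when every prime is covered *)

Section LargeCase.
Variables (q s m x j : nat).
Hypotheses (pq : prime q) (qo : odd q) (qm : q < m).
Hypothesis s16 : 16 <= s.
Hypothesis xm : x < m.
Hypothesis ms : m < s.+2 ^ 2.
Hypothesis xs : x <= s * 2 ^ j.
Hypothesis cov : forall p, s < p <= x -> prime p -> covered q s m p.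

Let LM := lnn s.+2.
(** The coefficient [1.055] bounds the sum of the class coefficients in all four cases below; the
    worst is [q >= 7], with about [1.0547]. The term [2 * LM] pays for the prime [q] itself,
    [5 / 2 * LM * INR j] for the logarithm of [q] in its class constant. *)
Let T := (1.055 * lnn 2 * INR x + 50 * lnn 2 * INR j + 5 / 2 * LM * INR j + 2 * LM)%R.
Let E := (INR x * tail_const 16 + INR j * (INR s / 2 * (2 * lnn 2 + 33 / 16 * lnn s)))%R.

Let x0 : (0 <= lnn 2 * INR x)%R.
Proof. by apply: Rmult_le_pos; [apply: lnn_ge0 | apply: pos_INR]. Qed.

Let j0 : (0 <= lnn 2 * INR j)%R.
Proof. by apply: Rmult_le_pos; [apply: lnn_ge0 | apply: pos_INR]. Qed.

Let LMj0 : (0 <= LM * INR j)%R.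
Proof. by apply: Rmult_le_pos; [apply: lnn_ge0 | apply: pos_INR]. Qed.

Let lnq : (lnn q <= 2 * LM)%R.
Proof.
have -> : (2 * LM = lnn (s.+2 ^ 2))%R by rewrite lnnX //= ; ring.
by apply: lnn_le; [apply: prime_gt0 | apply: ltnW; apply: ltn_trans ms].
Qed.

Let lnqj : (lnn q * INR j <= 2 * (LM * INR j))%R.
Proof.
rewrite -Rmult_assoc; apply: Rmult_le_compat_r; [exact: pos_INR | exact: lnq].
Qed.

Let psub p : s < p <= x -> p < m.
Proof. by case/andP=> _ px; apply: leq_ltn_trans xm. Qed.

Lemma theta_covered_ge7 : 7 <= q -> (theta s x predT <= T + E)%R.
Proof.
move=> q7.
have := @theta_cover_le s x j m s16 xs [:: 3; 5; 7; 11; 13]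
  (fun p => [&& (p < m)%N, q %| m - p & p != q] || pred1 q p).
rewrite !big_cons big_nil -/E => h.
apply: Rle_trans (h _) _.
  move=> p sp pp; case/or3P: (covered_split (cov sp pp)) => [d|b|->]; last by rewrite !orbT.
    by rewrite (psub sp) d /= orNb.
  apply/or3P/Or32; apply: sub_has b => r /andP[_ //].
apply: Rplus_le_compat_r.
have q5 : 5 <= q by lia.
have [b3 b5 b7 b11 b13] := @theta_sq_bad_small s x j m s16 xs.
have := @theta_dvd_small s x j m s16 xs q pq qo q5.
have -> : q == 5 = false by lia.
have := theta_or s x (fun p => [&& (p < m)%N, q %| m - p & p != q]) (pred1 q).
have := theta_pred1_le s x q; have := lnn_ge0 2.
(* The theta values become variables, leaving a linear problem. *)
move: (theta _ _ (pred1 q)) (theta _ _ (fun p => _ || _)) (theta _ _ (fun p => [&& _, _ & _])).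
move: (theta _ _ _) b3 (theta _ _ _) b5 (theta _ _ _) b7 (theta _ _ _) b11 (theta _ _ _) b13.
move: x0 j0 LMj0 lnq lnqj; rewrite /T; clear; move=> *; lra.
Qed.

(** The class of [r = 5] drops out, which compensates for the heavier class of [q = 5]. *)
Lemma theta_covered_5 : q = 5 -> (theta s x predT <= T + E)%R.
Proof.
move=> eq5.
have := @theta_cover_le s x j m s16 xs [:: 3; 7; 11; 13]
  (fun p => [&& (p < m)%N, q %| m - p & p != q] || pred1 q p).
rewrite !big_cons big_nil -/E => h.
apply: Rle_trans (h _) _.
  move=> p sp pp; case/or3P: (covered_split (cov sp pp)) => [d|b|->]; last by rewrite !orbT.
    by rewrite (psub sp) d /= orNb.
  by apply/or3P/Or32; move: b; rewrite /= eq5.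
apply: Rplus_le_compat_r.
have q5 : 5 <= q by lia.
have [b3 b5 b7 b11 b13] := @theta_sq_bad_small s x j m s16 xs.
have := @theta_dvd_small s x j m s16 xs q pq qo q5.
have -> : q == 5 by rewrite eq5.
have := theta_or s x (fun p => [&& (p < m)%N, q %| m - p & p != q]) (pred1 q).
have := theta_pred1_le s x q; have := lnn_ge0 2.
move: (theta _ _ (pred1 q)) (theta _ _ (fun p => _ || _)) (theta _ _ (fun p => [&& _, _ & _])).
move: (theta _ _ _) b3 (theta _ _ _) b7 (theta _ _ _) b11 (theta _ _ _) b13.
move: x0 j0 LMj0 lnq lnqj; rewrite /T; clear; move=> *; lra.
Qed.

(** If 3 divides both [m] and [m - p], then [p = 3]; the class of [q] costs at most one prime. *)
Lemma theta_covered_3_dvd : q = 3 -> 3 %| m -> (theta s x predT <= T + E)%R.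
Proof.
move=> eq3 m3.
have := @theta_cover_le s x j m s16 xs [:: 5; 7; 11; 13] (pred1 q).
rewrite !big_cons big_nil -/E => h.
apply: Rle_trans (h _) _.
  move=> p sp pp; case/or3P: (covered_split (cov sp pp)) => [d|b|->]; last by rewrite !orbT.
    have : 3 %| p by rewrite eq3 in d; move: d m3 (psub sp); clear; lia.
    by rewrite dvdn_prime2 // eq_sym -eq3 /= => ->.
  by apply/or3P/Or32; move: b; rewrite /= eq3.
apply: Rplus_le_compat_r.
have [b3 b5 b7 b11 b13] := @theta_sq_bad_small s x j m s16 xs.
have := theta_pred1_le s x q; have := lnn_ge0 2.
move: (theta _ _ (pred1 q)).
move: (theta _ _ _) b5 (theta _ _ _) b7 (theta _ _ _) b11 (theta _ _ _) b13.
move: x0 j0 LMj0 lnq lnqj; rewrite /T; clear; move=> *; lra.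
Qed.

(* A prime outside the class bad for [q = 3] lies in the other class modulo 3, which
   sharpens the bounds for [r = 5, 7]; the plain bounds would not suffice. *)
Lemma theta_covered_3_ndvd : q = 3 -> ~~ (3 %| m) -> (theta s x predT <= T + E)%R.
Proof.
move=> eq3 m3; have s3 : 3 <= s by lia.
pose P5 p := sq_bad m 5 p && ~~ (3 %| m - p).
pose P7 p := sq_bad m 7 p && ~~ (3 %| m - p).
pose P3 p := [&& (p < m)%N, 3 %| m - p & p != 3].
have := @theta_cover_le s x j m s16 xs [:: 11; 13] (fun p => P3 p || (P5 p || P7 p)).
rewrite !big_cons big_nil -/E => h.
apply: Rle_trans (h _) _.
  move=> p sp pp; rewrite /P3 /P5 /P7.
  have -> : p != 3 by move: sp s3; clear; lia.
  rewrite (psub sp).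
  have := covered_split (cov sp pp); rewrite eq3 /=.
  by case: (3 %| m - p) => //=; rewrite !andbT -!orbA.
apply: Rplus_le_compat_r.
have [b3 b5 b7 b11 b13] := @theta_sq_bad_small s x j m s16 xs.
have [b5' b7'] := @theta_sq_bad3_small s x j m s16 xs m3.
have := @theta_dvd_le s x j m s3 xs 3 isT isT.
have -> : (2 * INR 3 - 1 = 5)%R by rewrite /=; lra.
have [[l3a l3b] _ _ _ _] := prime_log_bounds.
have e2 : INR 3.-1 = 2%R by rewrite /=; lra.
rewrite e2 => b.
have {b} : (theta s x P3 <= 4.3781 * lnn 2 * (INR x / 5 + INR j))%R.
  apply: Rle_trans b _; apply: Rmult_le_compat_r.
    have := pos_INR x; have := pos_INR j; lra.
  have := lnn_ge0 2; lra.
have := theta_or s x P3 (fun p => P5 p || P7 p); have := theta_or s x P5 P7.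
move: b5' b7'; rewrite -/P5 -/P7.
have := lnn_ge0 2; have := lnn_ge0 q.
move: (theta _ _ (fun p => _ || (_ || _))) (theta _ _ (fun p => _ || _)).
move: (theta _ _ P3) (theta _ _ P5) (theta _ _ P7).
move: (theta _ _ _) b11 (theta _ _ _) b13.
move: x0 j0 LMj0 lnq lnqj; rewrite /T; clear; move=> *; lra.
Qed.

Lemma theta_covered : (theta s x predT <= T + E)%R.
Proof.
have [q7|q7] := leqP 7 q; first exact: theta_covered_ge7.
have : q = 3 \/ q = 5.
  by move: q7 pq qo; clear; case: q => [|[|[|[|[|[|[|?]]]]]]] //; [left | right].
case=> e; last exact: theta_covered_5.
have [d|d] := boolP (3 %| m); [exact: theta_covered_3_dvd | exact: theta_covered_3_ndvd].
Qed.
End LargeCase.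

(** If every prime between [s] and [x] were covered, the upper bound [theta_covered] would
    contradict Chebyshev's lower bound, by [final_numeric]. Here [x] is the largest multiple of 30
    below [m]. *)
Lemma large_case q s m : prime q -> odd q -> q < m -> 2 ^ 12 <= s ->
  s ^ 2 <= m < s.+1 ^ 2 -> exists2 p, prime p /\ p < m & 2 < p /\ ~~ covered q s m p.
Proof.
move=> pq qo qm s12 /andP[sm ms].
set n := m.-1 %/ 30; pose x := 30 * n.
have s16 : 16 <= s by apply: leq_trans s12.
have m0 : 0 < m by apply: leq_ltn_trans qm.
have xm : x < m by rewrite /x /n; move: m0; clear; lia.
have mx : m <= x + 30 by rewrite /x /n; move: m0; clear; lia.
(* Since [m < s.+1 ^ 2] gives [x <= s * s.+2], it suffices that [2 ^ j] exceeds [s.+2]. *)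
pose j := (trunc_log 2 s.+2).+1.
have j1 : s.+2 < 2 ^ j by rewrite trunc_log_ltn.
have j2 : 2 ^ j <= 2 * s.+2 by rewrite expnS leq_pmul2l // trunc_logP.
have xs : x <= s * 2 ^ j.
  apply: (@leq_trans (s * s.+2)); last by rewrite leq_mul2l (ltnW j1) orbT.
  by move: xm ms; rewrite -mulnn; clear; lia.
have [/hasP[p _ /and3P[sp pp nc]]|/hasPn h] :=
  boolP (has (fun p => [&& s < p <= x, prime p & ~~ covered q s m p]) (iota 0 x.+1)).
  exists p; first by split=> //; apply: leq_ltn_trans xm; case/andP: sp.
  by split=> //; move: sp s16; clear; lia.
have cov p : s < p <= x -> prime p -> covered q s m p.
  move=> sp pp; have := h p; rewrite mem_iota sp pp /= negbK; apply.
  by case/andP: sp.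
have n0 : 0 < n.
  rewrite /n divn_gt0 //; move: sm s16; rewrite -mulnn; clear; nia.
have ms2 : m < s.+2 ^ 2 by apply: ltn_trans ms _; rewrite ltn_exp2r.
have low := chebyshev_theta_ge n0 (ltn_trans xm ms).
have up := @theta_covered q s m x j pq qo qm s16 xm ms2 xs cov.
have [[l3a l3b] [l5a l5b] _ _ _] := prime_log_bounds.
have l2b := ln2_bounds.
have S4096 : (4096 <= INR s)%R.
  have -> : 4096%R = INR (2 ^ 12) by rewrite INR_IZR_INZ; congr IZR; lia.
  exact: leq_INR.
have XS : (INR s * INR s - 30 <= INR x)%R.
  have : s * s <= x + 30 by rewrite mulnn; apply: leq_trans mx.
  by move/leq_INR; rewrite INR_muln INR_addn (INR_IZR_INZ 30) /=; lra.
have J : (INR j * lnn 2 <= lnn 2 + lnn s.+2)%R.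
  by rewrite -lnnX // -lnnM //; apply: lnn_le; rewrite ?expn_gt0.
have LM : (lnn s.+2 <= 12 * lnn 2 + ln ((INR s + 2) / 4096))%R.
  have e : (12 * lnn 2 = ln 4096)%R.
    have : lnn (2 ^ 12) = (INR 12 * lnn 2)%R by rewrite lnnX.
    have -> : (INR 12 = 12)%R by rewrite INR_IZR_INZ.
    move=> <-; rewrite /lnn; congr ln; rewrite INR_IZR_INZ; congr IZR; lia.
  have -> : lnn s.+2 = ln (INR s + 2).
    by rewrite /lnn; congr ln; rewrite !S_INR; ring.
  rewrite e ln_div; lra.
have := final_numeric S4096 l2b (pos_INR j) XS J LM (lnn_ge0 _).
have t16 : tail_const 16 = ((33 / 64 * (4 * lnn 2) + 897 / 1000) / 16)%R.
  rewrite /tail_const (_ : lnn 16 = 4 * lnn 2)%R.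
    by rewrite (INR_IZR_INZ 16).
  by rewrite (_ : 16 = 2 ^ 4)%N // lnnX // (INR_IZR_INZ 4).
rewrite -t16 => fin.
have lx : (lnn x <= 2 * lnn s.+2)%R.
  have -> : (2 * lnn s.+2 = lnn (s.+2 ^ 2))%R by rewrite lnnX //= ; ring.
  apply: lnn_le; first by rewrite muln_gt0.
  exact: ltnW (ltn_trans xm ms2).
have ls : (lnn s <= lnn s.+2)%R by apply: lnn_le; move: s16; clear; lia.
have ex : INR x = (30 * INR n)%R by rewrite INR_muln (INR_IZR_INZ 30).
have a1 : ((INR s / 2 + 5) * lnn x <= (INR s / 2 + 5) * (2 * lnn s.+2))%R.
  by apply: Rmult_le_compat_l => //; lra.
have a2 : (INR j * (INR s / 2 * (2 * lnn 2 + 33 / 16 * lnn s)) <=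
           INR j * (INR s / 2 * (2 * lnn 2 + 33 / 16 * lnn s.+2)))%R.
  apply: Rmult_le_compat_l; first exact: pos_INR.
  by apply: Rmult_le_compat_l; lra.
(* From [prime_log_bounds]: [(14 + 9 * 84 / 53 + 5 * 65 / 28) / 30 >= 1.329]. *)
have a3 : (INR x * (1.329 * lnn 2) <= INR n * (14 * lnn 2 + 9 * lnn 3 + 5 * lnn 5))%R.
  rewrite ex; have := pos_INR n; nra.
move: low up fin a1 a2 a3; rewrite -/x.
move: (theta _ _ _) (lnn x) (tail_const 16); clear; move=> *; lra.
Qed.

(** * Class counts below [2 ^ 24] *)

Fixpoint strike (c r : nat) (l : seq bool) : seq bool :=
  if l is b :: l' then
    if c is c'.+1 then b :: strike c' r l' else false :: strike r r l'
  else [::].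

(* Index [i] stands for the odd number [2 * i + 1]. *)
Definition odd_sieve (n : nat) (rs : seq nat) : seq bool :=
  foldl (fun l r => strike r./2 r.-1 l) (false :: nseq n true) rs.

Fixpoint add_row (c : seq nat) (l : seq bool) : seq nat :=
  match c, l with
  | x :: c', b :: l' => (if b then x.+1 else x) :: add_row c' l'
  | _, _ => c
  end.

(** Cutting [l] into rows of length [k] and adding them columnwise counts all classes at once; [f]
    bounds the number of rows. *)
Fixpoint class_counts (f k : nat) (l : seq bool) : seq nat :=
  if f is f'.+1 then add_row (class_counts f' k (drop k l)) (take k l)
  else nseq k 0.

Definition max_class (k : nat) (l : seq bool) : nat :=
  foldr maxn 0 (class_counts (size l %/ k).+1 k l).

(** The classes are those of the index [i]; for odd [k] they correspond to the classes of
    [2 * i + 1]. *)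
Definition class_count (k c : nat) (l : seq bool) : nat :=
  count (fun i => nth false l i && (i %% k == c)) (iota 0 (size l)).

Lemma size_strike c r l : size (strike c r l) = size l.
Proof. by elim: l c => //= b l IHl [|c] /=; rewrite IHl. Qed.

Lemma nth_strike c r l i : c <= r ->
  nth false (strike c r l) i = nth false l i && ~~ (r.+1 %| i + (r.+1 - c)).
Proof.
elim: l c i => [|b l IHl] c i cr; first by rewrite /= nth_nil.
case: c cr => [|c] cr /=; case: i => [|i] /=.
- by rewrite subn0 add0n dvdnn andbF.
- by rewrite IHl // subn0 subSnn addn1 dvdn_addl.
- by rewrite gtnNdvd ?andbT //; lia.
by rewrite IHl ?(ltnW cr) //; do 3 f_equal; lia.
Qed.

Lemma size_odd_sieve n rs : size (odd_sieve n rs) = n.+1.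
Proof.
rewrite /odd_sieve -[RHS](size_nseq n.+1 true) -[size (nseq _ _)]/(size (false :: nseq n true)).
by elim: rs (_ :: _) => //= r rs IHrs l; rewrite IHrs size_strike.
Qed.

(** Striking starts at index [r./2], that is at [r] itself, so the sieving numbers are removed too.
    For odd [r], doubling turns the index condition into divisibility of [2 * i + 1]. *)
Lemma nth_odd_sieve n rs i : all odd rs ->
  nth false (odd_sieve n rs) i = [&& 0 < i, i <= n & all (fun r => ~~ (r %| i.*2.+1)) rs].
Proof.
move=> ors; have -> : [&& 0 < i, i <= n & all (fun r => ~~ (r %| i.*2.+1)) rs]
  = nth false (false :: nseq n true) i && all (fun r => ~~ (r %| i.*2.+1)) rs.
  by case: i => [|i] //=; rewrite nth_nseq; case: ifP.
rewrite /odd_sieve; elim: rs ors (_ :: _) => [|r rs IHrs] /=; first by move=> _ l; rewrite andbT.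
case/andP=> ro ors l; rewrite IHrs // nth_strike; last by lia.
rewrite -andbA; congr (_ && (~~ _ && _)); have r0 : 0 < r by case: (r) ro.
rewrite prednK // -(@Gauss_dvdr _ 2); last by rewrite coprimen2.
have -> : 2 * (i + (r - r./2)) = i.*2.+1 + r by lia.
by rewrite dvdn_addl.
Qed.

Lemma nth_add_row c l i :
  nth 0 (add_row c l) i = nth 0 c i + ((i < size c) && nth false l i).
Proof.
elim: c l i => [|x c IHc] [|b l] [|i] //=; rewrite ?nth_nil ?andbF ?addn0 //.
  by case: b; rewrite ?addn1 ?addn0.
Qed.

Lemma size_class_counts f k l : size (class_counts f k l) = k.
Proof.
have sz c m : size (add_row c m) = size c by elim: c m => [|x c IHc] [|b m] //=; rewrite IHc.
by elim: f l => [|f IHf] l /=; rewrite ?size_nseq // sz IHf.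
Qed.

Lemma class_count_drop k c l : c < k ->
  class_count k c l = class_count k c (drop k l) + nth false l c.
Proof.
move=> ck; rewrite /class_count size_drop.
have [lk|kl] := leqP (size l) k.
  rewrite (eqP (_ : size l - k == 0)) ?subn_eq0 //= add0n.
  have [cl|lc] := ltnP c (size l); last first.
    rewrite nth_default // (eq_in_count (a2 := pred0)) ?count_pred0 // => i.
    by rewrite mem_iota /= => il; rewrite modn_small; [lia | apply: leq_trans lk].
  rewrite (eq_in_count (a2 := fun i => (i == c) && nth false l c)).
    case: (nth false l c); last by rewrite (eq_count (a2 := pred0)) ?count_pred0 // => i; rewrite andbF.
    rewrite (eq_count (a2 := pred1 c)); last by move=> i; rewrite andbT.
    by rewrite count_uniq_mem ?iota_uniq // mem_iota /= cl.
  move=> i; rewrite mem_iota /= => il; rewrite modn_small; last by apply: leq_trans lk.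
  by case: eqP => [->|]; rewrite ?andbT ?andbF.
rewrite -{1}(subnK (ltnW kl)) addnC iotaD count_cat add0n addnC.
congr (_ + _).
  rewrite -[X in iota X]addn0 iotaDl count_map; apply: eq_count => i /=.
  by rewrite nth_drop modnDl.
rewrite (eq_in_count (a2 := fun i => (i == c) && nth false l c)).
  case: (nth false l c); last by rewrite (eq_count (a2 := pred0)) ?count_pred0 // => i; rewrite andbF.
  rewrite (eq_count (a2 := pred1 c)); last by move=> i; rewrite andbT.
  by rewrite count_uniq_mem ?iota_uniq // mem_iota /= ck.
move=> i; rewrite mem_iota /= => ik; rewrite modn_small //.
by case: eqP => [->|]; rewrite ?andbT ?andbF.
Qed.

Lemma nth_class_counts f k c l : c < k -> size l <= f * k ->
  nth 0 (class_counts f k l) c = class_count k c l.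
Proof.
move=> ck; elim: f l => [|f IHf] l lf.
  by case: l lf => //= _; rewrite nth_nseq ck.
rewrite /= nth_add_row size_class_counts ck IHf; last by rewrite size_drop; lia.
by rewrite nth_take // -class_count_drop.
Qed.

Lemma class_count_le_max k c l : c < k -> class_count k c l <= max_class k l.
Proof.
move=> ck; rewrite -(@nth_class_counts (size l %/ k).+1) //; last first.
  by apply: ltnW; rewrite mulSn addnC {1}(divn_eq (size l) k) ltn_add2l ltn_pmod //; lia.
rewrite /max_class; elim: (class_counts _ _ _) c {ck} => [|x s IHs] [|c] //=.
  exact: leq_maxl.
exact: leq_trans (IHs c) (leq_maxr _ _).
Qed.

(** Indices in one class have distinct quotients by [k]. *)
Lemma class_count_le_div k c l : 0 < k -> class_count k c l <= (size l %/ k).+1.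
Proof.
move=> k0; rewrite /class_count -size_filter -[X in _ <= X](size_iota 0).
rewrite -(size_map (fun i => i %/ k)); apply: uniq_leq_size.
  rewrite map_inj_in_uniq ?filter_uniq ?iota_uniq // => i j.
  rewrite !mem_filter => /andP[/andP[_ /eqP ei] _] /andP[/andP[_ /eqP ej] _] e.
  by rewrite (divn_eq i k) (divn_eq j k) ei ej e.
move=> x /mapP[i]; rewrite mem_filter mem_iota => /andP[_ /= il] ->.
by rewrite -[X in _ \in X]/(iota 0 (size l %/ k).+1) mem_iota /= ltnS leq_div2r // ltnW.
Qed.

Lemma sub_in_count (T : eqType) (a1 a2 : pred T) s :
  {in s, forall x, a1 x -> a2 x} -> count a1 s <= count a2 s.
Proof.
move=> h; rewrite (@eq_in_count _ a1 (predI a1 a2)).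
  by apply: sub_count => x /andP[].
by move=> x xs /=; apply/esym/andb_idr/h.
Qed.

(** * The union bound in counting form *)

Lemma count_dvd_class_le m d B l : odd d -> (forall c, c < d -> class_count d c l <= B) ->
  2 * size l <= m ->
  count (fun i => nth false l i && (d %| m - i.*2.+1)) (iota 0 (size l)) <= B.
Proof.
move=> od hB lm; have d0 : 0 < d by case: (d) od.
have [/hasP[i0]|] := boolP (has (fun i => nth false l i && (d %| m - i.*2.+1)) (iota 0 (size l))); last first.
  by rewrite has_count -leqNgt => h; apply: leq_trans h _.
rewrite mem_iota /= => i0l /andP[_ d_i0].
apply: leq_trans (hB (i0 %% d) (ltn_pmod _ d0)).
apply: sub_in_count => i; rewrite mem_iota /= => il /andP[-> di] /=.
have e : i.*2.+1 == i0.*2.+1 %[mod d].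
  have /eqP <- : m == i0.*2.+1 %[mod d] by rewrite eqn_mod_dvd //; lia.
  by rewrite eq_sym eqn_mod_dvd //; lia.
(* Ordering the indices keeps the subtraction from truncating; afterwards the factor 2 cancels
   because [d] is odd. *)
wlog le : i i0 i0l il d_i0 di e / i0 <= i.
  move=> h; case/orP: (leq_total i0 i) => le; first exact: h.
  by rewrite eq_sym h // eq_sym.
rewrite eqn_mod_dvd // -(@Gauss_dvdr _ 2) ?coprimen2 //.
by move: e; rewrite eqn_mod_dvd; [congr (_ %| _); lia | lia].
Qed.

Lemma count_predU_le (T : Type) (a b : pred T) s :
  count (predU a b) s <= count a s + count b s.
Proof. by rewrite -count_predUI leq_addr. Qed.

Lemma count_has_le (I J : Type) (s : seq I) (r : seq J) (a : pred I) (P : J -> pred I) :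
  count (fun i => a i && has (fun j => P j i) r) s
    <= \sum_(j <- r) count (fun i => a i && P j i) s.
Proof.
elim: r => [|j r IHr]; first by rewrite (eq_count (a2 := pred0)) ?count_pred0 // => i; rewrite andbF.
rewrite big_cons; apply: leq_trans (leq_add (leqnn _) IHr).
apply: leq_trans (count_predU_le _ _ _); apply: sub_count => i /=.
by rewrite andb_orr.
Qed.

(** The class bounds hold for every residue of [m], so one table serves all [m >= 2 * size l]. *)
Lemma static_case l s q m Bq (B : nat -> nat) : odd q ->
  (forall i, nth false l i -> prime i.*2.+1) -> 2 * size l <= m ->
  (forall c, c < q -> class_count q c l <= Bq) ->
  (forall r, r \in odd_primes q s -> forall c, c < r ^ 2 -> class_count (r ^ 2) c l <= B r) ->
  Bq + \sum_(r <- odd_primes q s) B r < count id l ->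
  exists2 p, prime p /\ p < m & 2 < p /\ ~~ covered q s m p.
Proof.
move=> oq pl lm hq hr; rewrite ltnNge => lt.
have [/hasP[i]|/hasPn h] := boolP (has (fun i => nth false l i && ~~ covered q s m i.*2.+1) (iota 0 (size l))).
  rewrite mem_iota /= => il /andP[li nc]; exists i.*2.+1; split=> //.
  - exact: pl.
  - by lia.
  by have := pl _ li; case: (i).
case/negP: lt.
have -> : count id l = count (nth false l) (iota 0 (size l)).
  by rewrite -[in LHS](mkseq_nth false l) /mkseq count_map.
apply: (@leq_trans (count (predU (fun i => nth false l i && (q %| m - i.*2.+1))
   (fun i => nth false l i && has (fun r => r ^ 2 %| m - i.*2.+1) (odd_primes q s))) (iota 0 (size l)))).
  apply: sub_in_count => i ir li /=; have := h i ir; rewrite li /= negbK /covered.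
  case/orP=> [-> //|/hasP[r rr /andP[_ d]]]; apply/orP; right.
  by apply/hasP; exists r.
apply: leq_trans (count_predU_le _ _ _) _.
apply: leq_add; first exact: count_dvd_class_le.
apply: leq_trans (count_has_le _ _ _ _) _.
rewrite big_seq [X in _ <= X]big_seq; apply: leq_sum => r rr.
apply: count_dvd_class_le (hr r rr) lm.
move: rr; rewrite mem_filter mem_index_iota => /andP[/andP[pr _] /andP[r3 _]].
by rewrite oddX; case: (even_prime pr) => // r2; move: r3; rewrite r2.
Qed.

Lemma leq_sum_uniq_sub (T : eqType) (s s' : seq T) (F : T -> nat) :
  uniq s -> uniq s' -> {subset s <= s'} -> \sum_(i <- s) F i <= \sum_(i <- s') F i.
Proof.
move=> us us' ss'; rewrite [X in _ <= X](bigID (mem s)) /=.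
apply: leq_trans (leq_addr _ _); rewrite -[X in _ <= X]big_filter.
apply/eq_leq/perm_big/uniq_perm; rewrite ?filter_uniq // => i.
by rewrite mem_filter; apply/esym/andb_idr/ss'.
Qed.

Lemma count_id_take l h : size [seq i <- iota 0 h | nth false l i] = count id (take h l).
Proof.
elim: h l => [|h IHh] [|b l] //=.
  rewrite (eq_in_filter (a2 := pred0)) ?filter_pred0 // => i _.
  by rewrite nth_nil.
have e : [seq i <- iota 1 h | nth false (b :: l) i] = [seq 1 + i | i <- iota 0 h & nth false l i].
  by rewrite (iotaDl 1 0 h) filter_map.
by rewrite -IHh; case: b e => /= ->; rewrite /= size_map.
Qed.

(* A square [r ^ 2] exceeding the sieved range kills at most one prime, so such [r < S]
   are merely counted ([large]); [B5] bounds the class counts of all primes [q >= 5]. *)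
Definition sieve_check (n K S : nat) : bool :=
  let rs := [seq r <- iota 3 K | prime r] in
  let l := odd_sieve n rs in
  let squares q := sumn [seq max_class (r ^ 2) l | r <- rs & r != q] in
  let large := count id (take S./2 l) in
  let B5 := maxn (max_class 5 l) (maxn (max_class 7 l) (size l %/ 11).+1) in
  [&& 2 * n + 1 < (K + 3) ^ 2, S./2 <= n.+1,
      max_class 3 l + (squares 3 + large) < count id l &
      B5 + (squares 2 + large) < count id l].

Lemma sieve_case n K S s q m : sieve_check n K S -> prime q -> odd q ->
  2 * n.+1 <= m -> s < S -> exists2 p, prime p /\ p < m & 2 < p /\ ~~ covered q s m p.
Proof.
rewrite /sieve_check; set rs := filter _ _; set l := odd_sieve n rs.
case/and4P=> nK Sn c3 c5 pq oq nm sS.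
have rs_odd : all odd rs.
  apply/allP => r; rewrite mem_filter mem_iota => /and3P[pr r3 _].
  by case: (even_prime pr) => // r2; move: r3; rewrite r2.
have l_size : size l = n.+1 by apply: size_odd_sieve.
have l_nth i : nth false l i = [&& 0 < i, i <= n & all (fun r => ~~ (r %| i.*2.+1)) rs].
  exact: nth_odd_sieve.
have l_prime i : nth false l i -> prime i.*2.+1.
  rewrite l_nth => /and3P[i0 il /allP h]; apply: ltn_pdiv2_prime => //.
  rewrite ltnNge; apply/negP => le.
  have pp : prime (pdiv i.*2.+1) by apply: pdiv_prime; lia.
  have dp := pdiv_dvd i.*2.+1.
  have : pdiv i.*2.+1 \in rs; last by move/h; rewrite dp.
  rewrite mem_filter pp mem_iota /=; apply/andP; split.
    have [e|] := eqVneq (pdiv i.*2.+1) 2; last by have := prime_gt1 pp; lia.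
    by move: dp; rewrite e dvdn2 /= odd_double.
  rewrite addnC -(ltn_exp2r _ _ (isT : 0 < 2)); apply: leq_ltn_trans le _.
  by apply: leq_ltn_trans nK; lia.
(* Outside [rs], [r ^ 2] exceeds the length of the table, so a class holds at most one index. *)
pose B r := if r \in rs then max_class (r ^ 2) l else 1.
have B_le r : r \in odd_primes q s -> forall c, c < r ^ 2 -> class_count (r ^ 2) c l <= B r.
  rewrite mem_filter mem_index_iota => /andP[/andP[pr _] /andP[r3 _]] c cr.
  rewrite /B mem_filter pr mem_iota r3 /=; case: ltnP => rK; first exact: class_count_le_max.
  apply: leq_trans (class_count_le_div _ _ _) _; first by apply: leq_ltn_trans cr.
  rewrite l_size divn_small //; apply: (@leq_trans (2 * n + 1).+1); first by lia.
  by apply: leq_trans nK _; rewrite leq_exp2r // addnC.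
(* Below, [q'] is 3 when [q = 3] and 2 otherwise; as 2 is not in [rs], the latter choice omits
   nothing. *)
have sum_le q' : (forall r, r \in rs -> r != q -> r != q') ->
    \sum_(r <- odd_primes q s) B r <=
    sumn [seq max_class (r ^ 2) l | r <- rs & r != q'] + count id (take S./2 l).
  move=> hq; rewrite (bigID (mem rs)) /=; apply: leq_add.
    have -> : \sum_(r <- odd_primes q s | r \in rs) B r
        = \sum_(r <- [seq r <- odd_primes q s | r \in rs]) max_class (r ^ 2) l.
      by rewrite big_filter; apply: eq_bigr => r rr; rewrite /B rr.
    rewrite sumnE big_map.
    apply: leq_sum_uniq_sub; rewrite ?filter_uniq ?iota_uniq // => r.
    rewrite mem_filter => /andP[/= rr].
    rewrite /odd_primes (mem_filter _ _ (index_iota _ _)) => /andP[/andP[_ rq] _].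
    by rewrite mem_filter rr hq.
  rewrite (eq_bigr (fun=> 1)); last by move=> r; rewrite /B => /negbTE ->.
  rewrite sum1_count -size_filter -count_id_take -(size_map half).
  have hr r : r \in [seq r <- odd_primes q s | r \notin rs] ->
      [/\ prime r, odd r, 3 <= r, r <= s & r \notin rs].
    rewrite mem_filter => /andP[rr]; rewrite mem_filter mem_index_iota.
    case/andP=> /andP[pr _] /andP[r3 rs']; split=> //.
    by case: (even_prime pr) => // r2; move: r3; rewrite r2.
  apply: uniq_leq_size.
    rewrite map_inj_in_uniq ?filter_uniq ?iota_uniq // => r r' /hr[_ o _ _ _] /hr[_ o' _ _ _] e.
    by rewrite -(odd_double_half r) -(odd_double_half r') o o' e.
  move=> i /mapP[r /hr[pr ro r3 rS rr] ->].
  (* A prime [r < S] outside [rs] survives the sieve, so it is among the entries counted in the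
     first [S./2] places. *)
  rewrite mem_filter mem_iota l_nth /= add0n.
  have e : r./2.*2.+1 = r by rewrite -[RHS](odd_double_half r) ro.
  have lt : r./2 < S./2 by lia.
  rewrite lt andbT e; apply/and3P; split; [lia | lia | apply/allP => r' r'rs].
  apply/negP => d; case/negP: rr.
  have pr' : prime r' by move: r'rs; rewrite mem_filter => /andP[].
  by move: d; rewrite dvdn_prime2 // => /eqP <-.
have fin Bq q' : (forall c, c < q -> class_count q c l <= Bq) ->
    (forall r, r \in rs -> r != q -> r != q') ->
    Bq + (sumn [seq max_class (r ^ 2) l | r <- rs & r != q'] + count id (take S./2 l)) < count id l ->
    exists2 p, prime p /\ p < m & 2 < p /\ ~~ covered q s m p.
  move=> h1 h2 h3; apply: (@static_case l s q m Bq B oq l_prime) => //.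
    by rewrite l_size.
  by apply: leq_ltn_trans h3; rewrite leq_add2l; apply: sum_le.
have [q3|qn3] := eqVneq q 3.
  by apply: fin c3; rewrite q3 // => c; apply: class_count_le_max.
apply: fin c5; last first.
  move=> r; rewrite mem_filter mem_iota => /andP[_ /andP[r3 _]] _.
  by apply: contraTneq r3 => ->.
move=> c cq; have [q5|qn5] := eqVneq q 5.
  by rewrite leq_max -q5 class_count_le_max.
have [q7|qn7] := eqVneq q 7.
  by rewrite !leq_max -q7 (class_count_le_max _ cq) orbT.
have q11 : 11 <= q.
  by move: pq oq qn3 qn5 qn7; clear; do 11 (case: q => [//|q]) => //.
rewrite !leq_max; apply/orP; right; apply/orP; right.
apply: leq_trans (class_count_le_div _ _ _) _; first by apply: prime_gt0.
by rewrite ltnS leq_div2l.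
Qed.

(** * Direct search for small even numbers *)

Definition square_freeb (d : nat) : bool :=
  (0 < d) && all (fun r => ~~ (r ^ 2 %| d)) (iota 2 13).

(** A prime whose square divides a positive [d < 15 ^ 2] is at most 14, the last trial divisor. *)
Lemma square_freebP d : d < 15 ^ 2 -> square_freeb d -> square_free d.
Proof.
move=> d15 /andP[d0 /allP h]; split=> // p pp; apply/negP => pd.
have : p \in iota 2 13.
  rewrite mem_iota prime_gt1 //= -(ltn_exp2r _ _ (isT : 0 < 2)).
  exact: leq_ltn_trans (dvdn_leq d0 pd) d15.
by move/h; rewrite pd.
Qed.

(* Two coprime values of [m - p] cannot share the factor [q]. *)
Definition small_check (m : nat) : bool :=
  let ps := [seq p <- iota 3 (m - 3) | prime p & square_freeb (m - p)] in
  has (fun p => has (fun p' => coprime (m - p) (m - p')) ps) ps.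

Lemma small_case q m : prime q -> m < 15 ^ 2 -> small_check m ->
  exists2 p, prime p /\ 2 < p < m & square_free (m - p) /\ coprime (m - p) q.
Proof.
move=> pq m15 /hasP[p hp /hasP[p' hp' cop]].
have h r : r \in [seq p <- iota 3 (m - 3) | prime p & square_freeb (m - p)] ->
    [/\ prime r, 2 < r < m & square_free (m - r)].
  rewrite mem_filter mem_iota => /andP[/andP[pr sq] /andP[r3 rm]].
  split=> //; first by lia.
  by apply: square_freebP sq; apply: leq_ltn_trans (leq_subr _ _) m15.
have [c|nc] := boolP (coprime (m - p) q).
  by exists p; have [] := h p hp.
exists p'; have [pr' rm' sq'] := h p' hp'; split=> //.
rewrite coprime_sym prime_coprime //; apply: contra nc => d'.
rewrite coprime_sym prime_coprime //; apply/negP => d.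
have : q %| gcdn (m - p) (m - p') by rewrite dvdn_gcd d.
by rewrite (eqP cop) dvdn1 => /eqP q1; move: pq; rewrite q1.
Qed.

Lemma small_check_all : all (fun m => odd m || small_check m) (iota 4 136).
Proof. by vm_compute. Qed.

(** This and the next two tables serve [140 <= m < 1000], [1000 <= m < 20000] and
    [20000 <= m < 2 ^ 24]: each starts at [2 * n.+1] and reaches up to [S ^ 2]. *)
Lemma sieve_check_140 : sieve_check 69 9 32.
Proof. by vm_compute. Qed.

Lemma sieve_check_1000 : sieve_check 499 41 142.
Proof. by vm_compute. Qed.

Lemma sieve_check_20000 : sieve_check (100 * 100 - 1) 139 (2 ^ 12).
Proof. by vm_compute. Qed.

(** * Assembling the ranges of [m] *)

Lemma even_eq_prime_add_square_free_lt q m : prime q -> odd q -> q < m -> ~~ odd m ->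
  exists2 p, prime p /\ 2 < p < m & square_free (m - p) /\ coprime (m - p) q.
Proof.
move=> pq oq qm me.
have [m140|m140] := ltnP m 140.
  apply: small_case => //; first by apply: leq_trans m140 _.
  have := allP small_check_all m; rewrite mem_iota (negbTE me) /=; apply.
  by move: m140 qm pq me; case: q oq => [|[|[|[|q]]]] //; lia.
have [s hs] := sqrt_exists m; have /andP[sm ms] := hs.
have fin : (exists2 p, prime p /\ p < m & 2 < p /\ ~~ covered q s m p) ->
    exists2 p, prime p /\ 2 < p < m & square_free (m - p) /\ coprime (m - p) q.
  case=> p [pp pm] [p2 nc]; exists p; first by rewrite p2.
  apply: not_covered nc => //.
  by case: (even_prime pp) => // e; move: p2; rewrite e.
apply: fin; have [s12|s12] := leqP (2 ^ 12) s; first exact: large_case.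
have lt_s S : m < S ^ 2 -> s < S.
  by move=> mS; rewrite -(ltn_exp2r _ _ (isT : 0 < 2)); apply: leq_ltn_trans mS.
have [m20|m20] := leqP (2 * (100 * 100)) m.
  by apply: (sieve_case sieve_check_20000).
have [m1400|m1400] := leqP 1000 m.
  by apply: (sieve_case sieve_check_1000) => //; apply: lt_s; apply: ltn_trans m20 _.
by apply: (sieve_case sieve_check_140) => //; apply: lt_s; apply: ltn_trans m1400 _.
Qed.

(** When [m <= q], the representation found for the prime 3 works: [m - p] is positive and below
    [q], hence prime to it. *)
Lemma even_eq_prime_add_square_free q m : prime q -> odd q -> ~~ odd m -> 3 < m ->
  exists2 p, prime p /\ 2 < p < m & square_free (m - p) /\ coprime (m - p) q.
Proof.
move=> pq oq me m4; have [qm|mq] := ltnP q m.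
  exact: even_eq_prime_add_square_free_lt.
have [p [pp pm] [sq _]] := @even_eq_prime_add_square_free_lt 3 m isT isT m4 me.
exists p => //; split=> //; rewrite coprime_sym prime_coprime // gtnNdvd //.
  by case: sq.
by move: pm mq; clear; lia.
Qed.

Theorem corollary6 (q : nat) (hq : prime q) (hq_range : 2 <= q < 10 ^ 5)
    (n : nat) (hn : 4 < n) :
  exists p1 p2 eta : nat,
    [/\ prime p1, prime p2, square_free eta, coprime eta q
      & n = p1 + p2 + eta].
Proof.
have even_case m : ~~ odd m -> 3 < m ->
    exists2 p, prime p /\ p < m & square_free (m - p) /\ coprime (m - p) q.
  move=> me m4; case: (even_prime hq) => [q2|oq]; last first.
    have [p [pp /andP[_ pm]] h] := even_eq_prime_add_square_free hq oq me m4.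
    by exists p.
  have [p [pp /andP[p2 pm]] [sq _]] := @even_eq_prime_add_square_free 3 m isT isT me m4.
  exists p => //; split=> //; rewrite q2 coprimen2 oddB ?(ltnW pm) // (negbTE me).
  by case: (even_prime pp) => // e; move: p2; rewrite e.
have sf1 : square_free 1 by split=> // p pp; rewrite dvdn1 -(exp1n 2) eqn_exp2r // neq_ltn prime_gt1 ?orbT.
(* For [n = 5] the even number [n - 3 = 2] is too small for the general argument. *)
have [->|n5] := eqVneq n 5; first by exists 2, 2, 1; rewrite coprime1n.
have [a pa [odd_a a_lt]] : exists2 a, prime a & ~~ odd (n - a) /\ 3 < n - a.
  by case o : (odd n); [exists 3 | exists 2] => //; move: hn n5 o; clear; lia.
have [p [pp pm] [sq co]] := even_case _ odd_a a_lt.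
by exists a, p, (n - a - p); split=> //; move: pm a_lt; clear; lia.
Qed.
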